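(* Let $X$ be a random variable with an arbitrary distribution on the open interval $]0,1[$, let $s_*$ be the unique positive solution of $$\mathbb{E}\left[\frac{e^{s(1-X)}-1}{1-X}\right]=1,$$ and let $v(T,s_* )$ be the optimal probability of recognising the last record before the horizon $T$ for the record process with factor $X$ and initial state $R_0=1$. Then $$v(T,s_* )>e^{-s_*}\quad\text{for all } T>s_* .$$ Moreover $s_*<1$, hence $$v(T,s_* )>e^{-1}\quad\text{for all } T>1,$$ and this bound is sharp: for $T>1$, the infimum of $v(T,s_* )$ over all distributions of $X$ on $]0,1[$ equals $e^{-1}$.
   Context: The record process with factor $X$ is the nonincreasing right-continuous Markov jump process $R=(R_t,\ t\ge0)$ which, when in state $r>0$, jumps at rate $r$ to a new state $rX'$, where $X'$ is a fresh independent copy of $X$. Equivalently, starting from $R_0=r_0$, the successive states after the jumps are $r_0X_1,\ r_0X_1X_2,\ldots$ and the successive sojourn times are $E_1/r_0,\ E_2/(r_0X_1),\ E_3/(r_0X_1X_2),\ldots$, where the $X_j$ are i.i.d. copies of $X$ and the $E_j$ are i.i.d. unit exponential variables independent of the $X_j$. A record occurs at time $t>0$ if $t$ is a jump time of $R$; time $0$ is not a record time. For $s>0$, $\pi_s$ is the policy that stops at the first record time $t<T$ with $(T-t)R_t\le s$ (and does not stop, hence does not succeed, if there is no such record time). With $R_0=1$, the value $v(T,s)$ is the probability that $\pi_s$ stops at the last record before $T$, $$v(T,s)=\mathbb{P}(R_{\pi_s-}>R_{\pi_s}=R_T,\ \pi_s<T);$$ equivalently, it is the probability that exactly one record time $t<T$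 satisfies $(T-t)R_t\le s$. The policy $\pi_{s_*}$ maximises the probability $\mathbb{P}(R_{\pi-}>R_\pi=R_T,\ \pi<T)$ over all stopping times $\pi$ of the natural right-continuous filtration of $R$, so $v(T,s_* )$ is the optimal probability. Both $s_*$ and $v(T,s_* )$ depend on the distribution of $X$. *)

(* Defs.v *)
From mathcomp Require Import all_boot all_order all_algebra finmap.
From mathcomp Require Import all_classical all_reals all_analysis.
Set Implicit Arguments.
Unset Strict Implicit.
Unset Printing Implicit Defensive.
Import Order.TTheory GRing.Theory Num.Theory.
Import numFieldNormedType.Exports.
Local Open Scope classical_set_scope.
Local Open Scope ring_scope.

Definition mutually_independent (R : realType) (d : measure_display)
    (Omega : measurableType d) (P : probability Omega R) (I : choiceType)
    (Y : I -> {RV P >-> R}) : Prop :=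
  forall (J : {fset I}) (A : I -> set R), (forall i, measurable (A i)) ->
    P (\bigcap_(i in [set` J]) (Y i @^-1` A i)) =
    (\prod_(i <- J) P (Y i @^-1` A i))%E.

(* [X] is an i.i.d. sequence with law [mu], [E] an i.i.d. sequence of unit
   exponential variables, and the two sequences are independent. *)
Definition record_inputs (R : realType) (mu : probability R R)
    (d : measure_display) (Omega : measurableType d) (P : probability Omega R)
    (X E : nat -> {RV P >-> R}) : Prop :=
  [/\ forall j A, measurable A -> distribution P (X j) A = mu A,
      forall j A, measurable A -> distribution P (E j) A = exponential_prob 1 A
    & mutually_independent
        (fun i : nat + nat => match i with inl j => X j | inr j => E j end)].

(* State after [n] jumps from the initial state 1. *)
Definition record_state (R : realType) (x : nat -> R) (n : nat) : R :=
  \prod_(j < n) x j.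

(* Time of the [n]-th jump; the 0-th one is the starting time 0. *)
Definition jump_time (R : realType) (x e : nat -> R) (n : nat) : R :=
  \sum_(j < n) e j / record_state x j.

(* The states decrease, so the state at time [t] is the least state entered by
   time [t].  This also gives a value after a possible explosion time, which
   has probability 0 of being finite. *)
Definition record_path (R : realType) (x e : nat -> R) (t : R) : R :=
  inf [set record_state x n | n in [set n | jump_time x e n <= t]].

Definition left_limit (R : realType) (r : R -> R) (t : R) : R :=
  lim (r u @[u --> t^'-]).

Definition record_time (R : realType) (r : R -> R) (t : R) : Prop :=
  0 < t /\ r t != left_limit r t.

(* The policy [pi_s] stops at [t] along the path [r]; if no [t] qualifies, it
   does not stop. *)
Definition stops_at (R : realType) (T s : R) (r : R -> R) (t : R) : Prop :=
  let eligible u := [/\ record_time r u, u < T & (T - u) * r u <= s] in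
  eligible t /\ forall u, eligible u -> t <= u.

(* R_{pi-} > R_pi = R_T and pi < T, for pi = pi_s. *)
Definition recognises_last (R : realType) (T s : R) (r : R -> R) : Prop :=
  exists t, [/\ stops_at T s r t, t < T, r t < left_limit r t & r t = r T].

(* The almost sure conditions 0 < x_j < 1 and 0 < e_j are part of the event, so
   that it is measurable whatever the random variables do on null sets. *)
Definition value (R : realType) (d : measure_display)
    (Omega : measurableType d) (P : probability Omega R)
    (X E : nat -> {RV P >-> R}) (T s : R) : \bar R :=
  P [set w | [/\ forall j, 0 < X j w < 1, forall j, 0 < E j w
    & recognises_last T s (record_path (fun j => X j w) (fun j => E j w))]].

Definition is_threshold (R : realType) (mu : probability R R)
    (s : R) : Prop :=
  0 < s /\ ('E_mu[(fun x : R => (expR (s * (1 - x)) - 1) / (1 - x))%R] = 1)%E.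

(* A value depends on the inputs only through the law [mu], so these are the
   numbers v(T, s_star) as [mu] ranges over the distributions on ]0, 1[. *)
Definition optimal_values (R : realType) (T : R) : set (\bar R) :=
  [set v | exists (mu : probability R R) (s : R)
      (d : measure_display) (Omega : measurableType d)
      (P : probability Omega R) (X E : nat -> {RV P >-> R}),
    [/\ mu `]0%R, 1%R[%classic = 1%E, is_threshold mu s, record_inputs mu X E
      & v = value X E T s]].

(* Main.v *)
(* Let S_n be the states, tau_n the jump times and z_n = (T - tau_n) S_n the scaled
   remaining time, so that z_0 = T and z_(n+1) = (z_n - E_n) X_n, and tau_(n+1) > T means
   E_n > z_n.  The policy stops when z_n <= s first holds, and it then succeeds with
   probability exp(- z_n).  Suppose z_n > s.  Either E_n > z_n - s, and the threshold
   equation E[(exp(s (1 - X)) - 1) / (1 - X)] = 1 says that the conditional probability to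
   stop at the next record and succeed is exp(- s); or the jump occurs earlier, and if it
   leads below s then the success probability is larger than exp(- s).  Hence
   P(success by step n) + exp(- s) P(not stopped by step n) does not decrease with n, and
   it increases strictly at the first step; the second term tends to 0.  If X = x is
   constant, then every stop that follows an early jump has z_n > s x, so exp(- s x) is an
   upper bound; as x -> 1, s_star -> 1 and the bound tends to exp(- 1).  The sequence of
   exponential variables needed for this example lives on [0, 1]: the even and the odd
   binary digits of a uniform variable give two independent uniform variables. *)
Require Import Defs.
From HB Require Import structures.
From mathcomp Require Import all_boot all_order all_algebra finmap.
From mathcomp Require Import all_classical all_reals all_analysis.
From mathcomp Require Import measurable_realfun ring lra.
Set Implicit Arguments.
Unset Strict Implicit.
Unset Printing Implicit Defensive.
Import Order.TTheory GRing.Theory Num.Theory.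
Import numFieldNormedType.Exports.
Local Open Scope classical_set_scope.
Local Open Scope ring_scope.

(** * Paths of the record process *)

(** The constant exp(- s) comes from one integral. From scaled remaining time [k > s] with factor
    [x], a waiting time [e] in [k - s, k[ leads to [(k - e) x < s], where the policy stops; the
    integral of exp(- (k - e) x) exp(- e) over these [e] is exp(- k) (exp(s (1 - x)) - 1) / (1 - x).
    By the threshold equation its average over X is exp(- k) = exp(- s) P(E > k - s). The integrand
    of that equation exceeds s on ]0, 1[, whence s_star < 1.

    Both bounds are the same computation with a free value [c] for the states where the policy still
    runs: exp(- s) from below, exp(- s x) from above. Running dies out geometrically, since another
    step requires E_n < z_n <= T.

    The event is stated on paths, through infima and left limits, and is first translated path by
    path, explosion included, into the chain. The Markov property of the chain is drawn from
    independence of finite families by absorbing E_0, X_0, E_1, ... one variable at a time. For the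
    example, splitting the odd digits again and again turns one uniform variable into a sequence,
    and inversion makes it exponential. *)

Section chain.
Context {R : realType}.

(* One step of the chain z_n, sent to 0 once the policy has stopped.  The guards on [e]
   and [x] matter on null sets only; they bound the chain by its initial value. *)
Definition stop_step (s z e : R) : R := if (s < z) && (0 < e) then z - e else 0.

Definition jump_step (y x : R) : R := if 0 < x < 1 then y * x else 0.

(** For valid inputs and [s < T], a value above [s] means that the policy still runs after [n]
    jumps, a value in ]0, s] that it stops at jump [n], and a value [<= 0] that the horizon has been
    reached or the policy stopped earlier. *)
Fixpoint chain (T s : R) (x e : nat -> R) (n : nat) : R :=
  if n is m.+1 then jump_step (stop_step s (chain T s x e m) (e m)) (x m)
  else T.

Lemma chain_le (T s : R) (x e : nat -> R) n : 0 < T -> chain T s x e n <= T.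
Proof.
move=> T0; elim: n => [|n IH] //=.
set y := stop_step _ _ _; have yT : y <= T.
  rewrite /y /stop_step; case: ifPn => [/andP[_ e0]|_]; last exact: ltW.
  by rewrite (le_trans _ IH)// gerBl ltW.
rewrite /jump_step; case: ifPn => [/andP[x0 x1]|_]; last exact: ltW.
have [y0|y0] := leP y 0; last by rewrite (le_trans _ yT)// ler_piMr ?ltW.
by rewrite (le_trans _ (ltW T0))// mulr_le0_ge0// ltW.
Qed.

(** One more running step forces the waiting time below the current value, hence below [T] by
    [chain_le]: the source of the geometric bound [prob_running_le]. *)
Lemma chain_running (T s : R) (x e : nat -> R) n : 0 < s ->
  s < chain T s x e n.+1 -> s < chain T s x e n /\ e n < chain T s x e n.
Proof.
move=> s0; rewrite /= /jump_step; case: ifPn => [/andP[x0 x1]|_]; last first.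
  by rewrite ltNge (ltW s0).
rewrite /stop_step; case: ifPn => [/andP[sk e0]|_]; last by rewrite mul0r ltNge (ltW s0).
by move=> /(lt_trans s0); rewrite pmulr_lgt0// subr_gt0.
Qed.

End chain.

Section path.
Context {R : realType} (x e : nat -> R).
Hypothesis x01 : forall j, 0 < x j < 1.
Hypothesis e_gt0 : forall j, 0 < e j.

Local Notation S := (record_state x).
Local Notation tau := (jump_time x e).
Local Notation r := (record_path x e).

Lemma record_stateS n : S n.+1 = S n * x n.
Proof. by rewrite /record_state big_ord_recr. Qed.

Lemma jump_timeS n : tau n.+1 = tau n + e n / S n.
Proof. by rewrite /jump_time big_ord_recr. Qed.

Lemma jump_time0 : tau 0 = 0.
Proof. by rewrite /jump_time big_ord0. Qed.

Lemma record_state0 : S 0 = 1.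
Proof. by rewrite /record_state big_ord0. Qed.

Lemma record_state_gt0 n : 0 < S n.
Proof. by apply: prodr_gt0 => j _; case/andP: (x01 j). Qed.

Lemma record_state_ltS n : S n.+1 < S n.
Proof.
rewrite record_stateS gtr_pMr ?record_state_gt0//.
by case/andP: (x01 n).
Qed.

Lemma jump_time_ltS n : tau n < tau n.+1.
Proof. by rewrite jump_timeS ltrDl divr_gt0 ?record_state_gt0. Qed.

Lemma jump_time_lt : {homo tau : m n / (m < n)%N >-> m < n}.
Proof. by apply: homo_ltn => [a b c|]; [exact: lt_trans|exact: jump_time_ltS]. Qed.

Lemma jump_time_le : {mono tau : m n / (m <= n)%N >-> m <= n}.
Proof. by move=> m n; exact: (le_mono jump_time_lt). Qed.

Lemma record_state_le m n : (m <= n)%N -> S n <= S m.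
Proof.
move=> mn; rewrite -lerN2.
move: m n mn; apply: (homo_leq (r := fun a b : R => - a <= - b)) => //.
  by move=> a b c; exact: le_trans.
by move=> i; rewrite lerN2 ltW ?record_state_ltS.
Qed.

Lemma record_path_lb t : lbound [set S n | n in [set n | tau n <= t]] 0.
Proof. by move=> _ [n _ <-]; exact/ltW/record_state_gt0. Qed.

Lemma record_path_le t n : tau n <= t -> r t <= S n.
Proof.
move=> nt; apply: ge_inf; last by exists n.
by exists 0; exact: record_path_lb.
Qed.

Lemma record_path_between t n : tau n <= t -> t < tau n.+1 -> r t = S n.
Proof.
move=> nt tn; apply/eqP; rewrite eq_le record_path_le//=.
apply: lb_le_inf; first by exists (S n), n.
move=> _ [m /= mt <-]; apply: record_state_le.
by rewrite -ltnS ltnNge -jump_time_le -ltNge (le_lt_trans mt).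
Qed.

Lemma left_limit_between t n : tau n < t -> t <= tau n.+1 ->
  left_limit r t = S n.
Proof.
move=> nt tn; apply: norm_lim_near_cst.
near=> u; apply: record_path_between.
  by near: u; exact: nbhs_left_ge.
by apply: lt_le_trans tn; near: u; exact: nbhs_left_lt.
Unshelve. all: by end_near. Qed.

(** Here [r t] is the infimum of all states; from the entry into a state within [eps] of it, the
    path stays between the two. Accumulating jump times thus create no record. *)
Lemma left_limit_explosion t : (forall n, tau n <= t) -> left_limit r t = r t.
Proof.
move=> taut; apply/cvg_lim => //; apply/cvgrPdist_le => eps eps0.
have tau_lt n : tau n < t by exact: lt_le_trans (jump_time_ltS n) (taut _).
have [|_ [N _ <-] SN] := @inf_adherent _ [set S n | n in [set n | tau n <= t]] eps eps0.
  by split; [exists (S 0), 0; rewrite //= | exists 0; exact: record_path_lb].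
near=> u.
have Nu : tau N <= u by near: u; exact: nbhs_left_ge.
have ut : u < t by near: u; exact: nbhs_left_lt.
rewrite ler_distl; apply/andP; split.
  rewrite lerBlDr (le_trans (record_path_le Nu))// ltW//.
have : r t <= r u.
  apply: lb_le_inf; first by exists (S N), N.
  by move=> _ [m _ <-]; exact: record_path_le.
by move=> /le_trans; apply; rewrite lerDl ltW.
Unshelve. all: by end_near. Qed.

(** Apart from explosion, the first jump time at or after [t] closes an interval on which the path
    is constant, so a record can only sit at its end. The index starts at 1 because time 0 is not a
    record. *)
Lemma record_timeP t : record_time r t <-> exists n, t = tau n.+1.
Proof.
split=> [[t0 rt]|[n ->]].
  have [h|/existsNP[N /negP]] := pselect (forall n, tau n <= t).
    by move: rt; rewrite left_limit_explosion// eqxx.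
  rewrite -ltNge => tN.
  have exN : exists N, t <= tau N by exists N; rewrite ltW.
  case: (ex_minnP exN) => -[|n].
    by rewrite jump_time0 leNgt t0.
  move=> tn minn.
  have nt : tau n < t by rewrite ltNge; apply/negP => /minn; rewrite ltnn.
  exists n; apply/eqP; rewrite eq_le tn/= leNgt; apply/negP => tn'.
  by move: rt; rewrite (left_limit_between nt)// (record_path_between _ tn') ?eqxx// ltW.
split; first by rewrite -jump_time0 jump_time_lt.
rewrite (left_limit_between (jump_time_ltS n))// (record_path_between _ (jump_time_ltS _))//.
by rewrite lt_eqF// record_state_ltS.
Qed.

(** Every jump strictly lowers the path, so [r t = r T] at [t = tau n.+1] amounts to [T < tau n.+2];
    the sign is strict since a jump exactly at [T] already breaks the equality. *)
Lemma recognises_lastP T s : recognises_last T s r <->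
  exists n, [/\ tau n.+1 < T, (T - tau n.+1) * S n.+1 <= s,
    forall k, (k < n)%N -> s < (T - tau k.+1) * S k.+1 & T < tau n.+2].
Proof.
have rtau n : r (tau n) = S n by rewrite (record_path_between _ (jump_time_ltS n)).
split.
  move=> [t [[[/record_timeP[n ->] nT ns] mint] _ _]].
  rewrite rtau => rT; exists n; split => //.
  - by move: ns; rewrite rtau.
  - move=> k kn; rewrite ltNge; apply/negP => ks.
    have : tau n.+1 <= tau k.+1.
      apply: mint; split; last by rewrite rtau.
      - by apply/record_timeP; exists k.
      - by apply: lt_trans nT; rewrite jump_time_lt.
    by rewrite jump_time_le ltnS leqNgt kn.
  - rewrite ltNge; apply/negP => /record_path_le; rewrite -rT.
    by rewrite leNgt record_state_ltS.
move=> [n [nT ns before Tn]]; exists (tau n.+1); split => //.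
- split.
    split => //; last by rewrite rtau.
    by apply/record_timeP; exists n.
  move=> _ [/record_timeP[k ->] kT ks]; rewrite jump_time_le ltnS leqNgt.
  by apply/negP => /before; rewrite ltNge; move: ks; rewrite rtau => ->.
- by rewrite rtau (left_limit_between (jump_time_ltS n))// record_state_ltS.
- by rewrite rtau (record_path_between (ltW nT) Tn).
Qed.

Section with_chain.
Variables (T s : R).
Hypotheses (s0 : 0 < s) (sT : s < T).
Local Notation k := (chain T s x e).

Lemma chain_absorbing m n : (m < n)%N -> k m <= s -> k n = 0.
Proof.
have kS i : k i <= s -> k i.+1 = 0.
  by move=> ks; rewrite /= /stop_step ltNge ks/= /jump_step mul0r if_same.
move=> + ms; elim: n => // n IH; rewrite ltnS leq_eqVlt => /predU1P[<-|mn].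
  exact: kS.
by apply: kS; rewrite IH// ltW.
Qed.

Lemma chain_gt0 m n : (m < n)%N -> 0 < k n -> s < k m.
Proof.
by move=> mn kn; rewrite ltNge; apply/negP => /(chain_absorbing mn) k0; move: kn; rewrite k0 ltxx.
Qed.

(** One step is the identity (T - tau - e / S) S x = ((T - tau) S - e) x, valid as long as the
    policy has not stopped before. *)
Lemma chainE n : (forall m, (m < n)%N -> s < k m) -> k n = (T - tau n) * S n.
Proof.
elim: n => [|n IH] h; first by rewrite jump_time0 record_state0 subr0 mulr1.
rewrite [LHS]/= /stop_step h// e_gt0/= /jump_step x01 IH; last first.
  by move=> m mn; apply: h; rewrite ltnS ltnW.
rewrite jump_timeS record_stateS; field.
by rewrite gt_eqF ?record_state_gt0.
Qed.

(** [k n < e n] says that no jump follows by time [T]. The index 0, which is no record, is ruled out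
    by [k 0 = T > s]. *)
Lemma recognises_last_chain : recognises_last T s r <->
  exists n, 0 < k n <= s /\ k n < e n.
Proof.
have tauS n : (T - tau n) * S n < e n <-> T < tau n.+1.
  by rewrite -ltr_pdivlMr ?record_state_gt0// jump_timeS ltrBlDl.
rewrite recognises_lastP; split=> [[n [nT ns before Tn]]|[n [/andP[k0 ks] ke]]].
  have h m : (m < n.+1)%N -> s < k m.
    (* [chainE] at [m] presupposes that all earlier values exceed [s], hence strong induction; index
       0 is [s < T]. *)
    elim/ltn_ind: m => -[_ _//|m IH]; rewrite ltnS => mn.
    rewrite chainE; first exact: before.
    by move=> i im; apply: IH => //; rewrite (ltn_trans im).
  exists n.+1; rewrite chainE//; split.
    by rewrite ns mulr_gt0 ?record_state_gt0// subr_gt0.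
  exact/tauS.
case: n => [|n] in k0 ks ke *; first by move: ks; rewrite /= leNgt sT.
have h m : (m < n.+1)%N -> s < k m by move=> mn; exact: chain_gt0 mn k0.
have kE m : (m <= n.+1)%N -> k m = (T - tau m) * S m.
  by move=> mn; apply: chainE => i im; apply: h; exact: leq_trans im mn.
exists n; rewrite -!kE//; split => //.
- by move: k0; rewrite kE// pmulr_lgt0 ?record_state_gt0// subr_gt0.
- by move=> i im; rewrite -kE// ?h// ltnW.
- by apply/tauS; rewrite -kE.
Qed.

End with_chain.
End path.

(* [R] and [measurableTypeR R] have the same measurable sets but different displays. *)
Definition to_real {R : realType} : measurableTypeR R -> R := idfun.

Lemma measurable_to_real (R : realType) : measurable_fun setT (@to_real R).
Proof. by move=> _ A mA; rewrite setTI. Qed.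

HB.instance Definition _ (R : realType) :=
  isMeasurableFun.Build _ _ _ _ (@to_real R) (@measurable_to_real R).

Lemma measurable_preimage d1 d2 (T1 : measurableType d1) (T2 : measurableType d2)
    (f : T1 -> T2) (A : set T2) :
  measurable_fun setT f -> measurable A -> measurable (f @^-1` A).
Proof. by move=> mf mA; rewrite -[_ @^-1` _]setTI; exact: mf. Qed.

(** * Independence *)

Section joint_law.
Context d1 d2 d3 (Omega : measurableType d1) (T1 : measurableType d2)
  (T2 : measurableType d3) {R : realType} (P : probability Omega R).
Variables (m : probability T2 R) (Z : Omega -> T1) (Y : Omega -> T2)
  (G : set Omega).
Hypotheses (mZ : measurable_fun setT Z) (mY : measurable_fun setT Y)
  (mG : measurable G).
Hypothesis ZYG : forall A B, measurable A -> measurable B ->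
  P (Z @^-1` A `&` (Y @^-1` B `&` G)) = (P (Z @^-1` A) * (m B * P G))%E.

Let Zm : {mfun Omega >-> T1} := HB.pack Z (isMeasurableFun.Build _ _ _ _ _ mZ).

Let mZY : measurable_fun setT (fun w => (Z w, Y w)).
Proof. exact: measurable_fun_pair. Qed.

(** Two finite measures that agree on rectangles coincide: the law of [(Z, Y)] restricted to [G],
    and the product law scaled by [P G]. The event [G] will carry the later inputs. *)
Lemma joint_law_setI (S : set (T1 * T2)) : measurable S ->
  P ((fun w => (Z w, Y w)) @^-1` S `&` G) = ((distribution P Zm \x m) S * P G)%E.
Proof.
move=> mS.
have PG0 : 0 <= fine (P G) by rewrite fine_ge0.
have mP : forall D, measurable D -> P D \is a fin_num by move=> D mD; exact: fin_num_measure.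
pose k := NngNum PG0.
pose ZY : {mfun Omega >-> (T1 * T2)%type} :=
  HB.pack (fun w => (Z w, Y w)) (isMeasurableFun.Build _ _ _ _ _ mZY).
have kE : (k%:num%:E = P G)%E by rewrite /k/= fineK ?mP.
pose m' : {measure set (T1 * T2) -> \bar R} :=
  measure_function_pushforward__canonical__measure_function_Measure (mrestr P mG) mZY.
have := @product_measure_unique _ _ _ _ _ (mscale k (distribution P Zm)) m m' _ S mS.
rewrite {2}/m' /= /pushforward /mrestr => <- /=.
  rewrite /product_measure1 ge0_integral_mscale//=.
    by rewrite kE muleC.
  by move: (measurable_fun_xsection m mS).
move=> A B mA mB.
rewrite /m' /= /pushforward /mrestr /mscale /distribution /pushforward/=.
rewrite kE.
have -> : (fun w => (Z w, Y w)) @^-1` (A `*` B) = Z @^-1` A `&` Y @^-1` B.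
  by apply/seteqP; split.
rewrite -setIA ZYG//.
by rewrite -[RHS]muleA [RHS]muleC -muleA.
Qed.

End joint_law.

Section integral_joint.
Context d1 d2 d3 (Omega : measurableType d1) (T1 : measurableType d2)
  (T2 : measurableType d3) {R : realType} (P : probability Omega R).
Variables (m : probability T2 R) (Z : Omega -> T1) (Y : Omega -> T2).
Hypotheses (mZ : measurable_fun setT Z) (mY : measurable_fun setT Y).
Hypothesis ZY : forall A B, measurable A -> measurable B ->
  P (Z @^-1` A `&` Y @^-1` B) = (P (Z @^-1` A) * m B)%E.
Variable f : T1 * T2 -> \bar R.
Hypotheses (mf : measurable_fun [set: T1 * T2] f) (f0 : forall z, (0 <= f z)%E).

Let Zm : {mfun Omega >-> T1} := HB.pack Z (isMeasurableFun.Build _ _ _ _ _ mZ).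

Let mZY : measurable_fun setT (fun w => (Z w, Y w)).
Proof. exact: measurable_fun_pair. Qed.

Let integral_joint_prod : (\int[P]_w f (Z w, Y w) =
  \int[distribution P Zm \x m]_z f z)%E.
Proof.
rewrite -[LHS]/(\int[P]_w (f \o (fun w => (Z w, Y w))) w)%E.
have := @ge0_integral_pushforward _ _ _ _ _ _ mZY P setT f measurableT mf (fun z _ => f0 z).
rewrite preimage_setT => <-.
apply: eq_measure_integral => S mS _.
have := @joint_law_setI _ _ _ _ _ _ _ P m Z Y setT mZ mY measurableT _ S mS.
rewrite setIT probability_setT mule1; apply => A B mA mB.
by rewrite setIT mule1 ZY.
Qed.

Lemma integral_joint1 :
  (\int[P]_w f (Z w, Y w) = \int[P]_w \int[m]_y f (Z w, y))%E.
Proof.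
rewrite integral_joint_prod fubini_tonelli1//.
have := @ge0_integral_pushforward _ _ _ _ _ _ mZ P setT (fubini_F m f) measurableT.
rewrite preimage_setT; apply.
- exact: measurable_fun_fubini_tonelli_F.
- by move=> z _; apply: integral_ge0.
Qed.

End integral_joint.

Section indep_future.
Context d (Omega : measurableType d) {R : realType} (P : probability Omega R).

(** Splitting the right-hand side into single factors also records the mutual independence of the
    inputs (take [C = setT]), which is what lets the property pass to the shifted sequence. *)
Definition indep_future (Z : Omega -> R) (Y : nat -> Omega -> R) :=
  forall (A : nat -> set R) C N, (forall i, measurable (A i)) -> measurable C ->
  P (Z @^-1` C `&` \big[setI/setT]_(i < N) (Y i @^-1` A i)) =
  (P (Z @^-1` C) * \prod_(i < N) P (Y i @^-1` A i))%E.

Lemma indep_future_pair Z Y : indep_future Z Y -> forall A B, measurable A -> measurable B ->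
  P (Z @^-1` A `&` Y 0%N @^-1` B) = (P (Z @^-1` A) * P (Y 0%N @^-1` B))%E.
Proof.
move=> ZY A B mA mB; have := ZY (fun=> B) A 1 (fun=> mB) mA.
by rewrite !big_ord1.
Qed.

(** The new state depends on [(Z, Y 0)] only; [joint_law_setI], with [G] the event on the later
    inputs, makes this pair independent of them. *)
Lemma indep_future_step (m : probability R R) Z Y (f : R * R -> R) :
  measurable_fun setT Z -> (forall i, measurable_fun setT (Y i)) ->
  measurable_fun [set: R * R] f ->
  (forall A, measurable A -> P (Y 0%N @^-1` A) = m A) ->
  indep_future Z Y ->
  indep_future (fun w => f (Z w, Y 0%N w)) (fun i => Y i.+1).
Proof.
move=> mZ mY mf Ym ZY A C N mA mC.
have mpre (X : Omega -> R) D : measurable_fun setT X -> measurable D -> measurable (X @^-1` D).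
  by move=> mX mD; rewrite -[_ @^-1` _]setTI; exact: mX.
have mfC : measurable (f @^-1` C) by rewrite -[_ @^-1` _]setTI; exact: mf.
set G := \big[setI/setT]_(i < N) _.
have mG : measurable G by apply: bigsetI_measurable => i _; exact: mpre.
have ZYG D B : measurable D -> measurable B ->
    P (Z @^-1` D `&` (Y 0%N @^-1` B `&` G)) =
    (P (Z @^-1` D) * (m B * \prod_(i < N) P (Y i.+1 @^-1` A i)))%E.
  move=> mD mB.
  have := ZY (fun i => if i is j.+1 then A j else B) D N.+1.
  rewrite !big_ord_recl/= Ym// => <-//.
  by case.
have PG : P G = (\prod_(i < N) P (Y i.+1 @^-1` A i))%E.
  have := ZYG setT setT measurableT measurableT.
  by rewrite !preimage_setT !setTI !probability_setT !mul1e.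
rewrite -PG in ZYG *.
have := @joint_law_setI _ _ _ _ _ _ _ P m Z (Y 0%N) G mZ (mY 0%N) mG ZYG _ mfC.
rewrite -[X in P (X `&` _)]/((fun w => f (Z w, Y 0%N w)) @^-1` C) => ->.
have := @joint_law_setI _ _ _ _ _ _ _ P m Z (Y 0%N) setT mZ (mY 0%N) measurableT _ _ mfC.
rewrite setIT probability_setT mule1 => <-// D B mD mB.
by rewrite setIT mule1 -Ym//; exact: indep_future_pair.
Qed.

End indep_future.

(** * Exponential waiting times *)

Section exponential_law.
Context {R : realType}.
Local Notation leb := (@lebesgue_measure R).

Lemma integral_expR_affine (u v a b : R) : u != 0 -> a < b ->
  (\int[leb]_(t in `[a, b]) (expR (u * t + v))%:E =
   ((expR (u * b + v) - expR (u * a + v)) / u)%:E)%E.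
Proof.
move=> u0 ab.
have cE : continuous (fun t : R => expR (u * t + v)).
  move=> t; apply: continuous_comp; last exact: continuous_expR.
  apply: cvgD; last exact: cvg_cst.
  by apply: cvgM => //; exact: cvg_cst.
rewrite (@continuous_FTC2 _ _ (fun t => expR (u * t + v) / u))//.
- by rewrite -EFinB mulrBl.
- exact: continuous_subspaceT.
- split.
  + by move=> t _; exact: ex_derive.
  + apply: cvg_at_right_filter; apply: cvgM; [exact: cE|exact: cvg_cst].
  + apply: cvg_at_left_filter; apply: cvgM; [exact: cE|exact: cvg_cst].
- by move=> t _; rewrite derive1E derive_val /GRing.scale/= !(mulr0, addr0); field.
Qed.

Definition unit_exponential : probability (measurableTypeR R) R :=
  exponential_distribution_exponential_prob__canonical__probability_measure_Probability
    (@ltr01 R).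

Lemma dominates_unit_exponential : unit_exponential `<< leb.
Proof.
apply/null_content_dominatesP => A mA A0.
rewrite /= /exponential_prob; apply: null_set_integral => //.
by apply/measurable_funTS/measurable_EFinP; exact: measurable_exponential_pdf.
Qed.

(** The law is given by a density on sets. The Radon-Nikodym change of variables carries this to
    functions, and the derivative equals the density almost everywhere because both have the same
    integral over every measurable set. *)
Lemma integral_unit_exponential (f : R -> \bar R) :
  unit_exponential.-integrable setT f ->
  (\int[unit_exponential]_x f x = \int[leb]_x (f x * (exponential_pdf 1 x)%:E))%E.
Proof.
move=> fint; have mf := measurable_int _ fint.
rewrite -(Radon_Nikodym_change_of_variables dominates_unit_exponential)//.
apply: ae_eq_integral => //.
- apply: emeasurable_funM => //; apply: (measurable_int leb).
  by apply: Radon_Nikodym_integrable; exact: dominates_unit_exponential.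
- apply: emeasurable_funM => //=; apply/measurable_EFinP.
  exact: measurable_exponential_pdf.
- apply: ae_eqe_mul2l => /=.
  rewrite Radon_NikodymE//=; first exact: dominates_unit_exponential.
  move=> dom; case: cid => /= h [h1 h2 h3].
  apply: integral_ae_eq => //=.
  + by apply/measurable_EFinP; exact: measurable_exponential_pdf.
  + by move=> E _ mE; rewrite -h3.
Qed.

Lemma unit_exponential_le (t : R) : 0 <= t ->
  unit_exponential `]-oo, t]%classic = (1 - expR (- t))%:E.
Proof.
have neg0 : exponential_prob (1 : R) `]-oo, 0[%classic = 0%E.
  rewrite /exponential_prob; apply: integral0_eq => e /=.
  by rewrite in_itv/= => e0; rewrite lt0_exponential_pdf.
have all0 : exponential_prob (1 : R) [set 0] = 0%E.
  by rewrite /exponential_prob integral_set1.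
rewrite le_eqVlt => /predU1P[<-|t0].
  rewrite oppr0 expR0 subrr -(@setUitv1 _ _ _ _ true)// measureU//=.
    by rewrite neg0 all0 adde0.
  by apply/seteqP; split => // e [] /=; rewrite in_itv/= => + e0; rewrite e0 ltxx.
rewrite (@itv_bndbnd_setU _ _ _ (BLeft 0)) ?bnd_simp ?ltW// measureU//=.
  by rewrite neg0 add0e /= exponential_prob_itv0c// mulN1r EFinB.
apply/seteqP; split => // e [] /=; rewrite !in_itv/= => e0 /andP[].
by rewrite leNgt e0.
Qed.

Lemma unit_exponential_gt (t : R) : 0 <= t ->
  unit_exponential `]t, +oo[%classic = (expR (- t))%:E.
Proof.
move=> t0; rewrite -setCitvl probability_setC// unit_exponential_le//.
by rewrite -EFinB opprB addrC subrK.
Qed.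

(* The gain [expR (- z)] on stopping at scaled remaining time [z], with the
   value [c] assigned to the states in which the policy does not stop. *)
Definition gain (s c z : R) : R :=
  if 0 < z <= s then expR (- z) else if s < z then c else 0.

(** The integrand of the threshold equation. For [k > s] and [0 < x < 1], [expR (- k) * defect s x]
    is the probability that, from scaled remaining time [k] with factor [x], the next jump falls in
    the last stretch of length [s] and is the last one. *)
Definition defect (s x : R) : R := (expR (s * (1 - x)) - 1) / (1 - x).

Lemma measurable_gain (s c : R) : measurable_fun setT (gain s c).
Proof.
apply: measurable_fun_ifT => //=.
- by apply: measurable_and; [apply: measurable_fun_ltr|apply: measurable_fun_ler].
- exact: measurableT_comp.
- by apply: measurable_fun_ifT => //=; apply: measurable_fun_ltr.
Qed.

Lemma measurable_stop_step d (T : measurableType d) (s : R) (f g : T -> R) :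
  measurable_fun setT f -> measurable_fun setT g ->
  measurable_fun setT (fun t => stop_step s (f t) (g t)).
Proof.
move=> mf mg; apply: measurable_fun_ifT => //=.
- by apply: measurable_and; apply: measurable_fun_ltr.
- exact: measurable_funB.
Qed.

Lemma measurable_jump_step d (T : measurableType d) (f g : T -> R) :
  measurable_fun setT f -> measurable_fun setT g ->
  measurable_fun setT (fun t => jump_step (f t) (g t)).
Proof.
move=> mf mg; apply: measurable_fun_ifT => //=.
- by apply: measurable_and; apply: measurable_fun_ltr.
- exact: measurable_funM.
Qed.

Lemma gain_ge0 (s c z : R) : 0 <= c -> 0 <= gain s c z.
Proof. by move=> c0; rewrite /gain; do 2 case: ifP => // _; rewrite expR_ge0. Qed.

Lemma gain_le1 (s c z : R) : c <= 1 -> gain s c z <= 1.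
Proof.
move=> c1; rewrite /gain; case: ifPn => [/andP[z0 _]|_]; last by case: ifP.
by rewrite -[leRHS]expR0 ler_expR oppr_le0 ltW.
Qed.

(** The waiting time is cut at [k - s] and [k]. Beyond [k] the horizon has passed and the gain is 0;
    in between the landing point is at most [s x < s], so the gain is explicit and free of [c]. *)
Lemma integral_gain (s c k x : R) : 0 < s -> s < k -> 0 < x < 1 -> 0 <= c <= 1 ->
  (\int[unit_exponential]_e (gain s c (jump_step (stop_step s k e) x))%:E =
   \int[leb]_(e in `]0%R, (k - s)%R[) (gain s c ((k - e) * x) * expR (- e))%:E +
   (expR (- k) * defect s x)%:E)%E.
Proof.
move=> s0 sk x01 /andP[c0 c1]; have /andP[x0 x1] := x01.
have mg : measurable_fun setT (fun e : R => gain s c ((k - e) * x)).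
  apply: measurableT_comp; first exact: measurable_gain.
  by apply: measurable_funM => //; exact: measurable_funB.
have mgE : measurable_fun setT (fun e : R => (gain s c ((k - e) * x) * expR (- e))%:E).
  apply/measurable_EFinP/measurable_funM => //.
  by apply: measurableT_comp => //; exact: measurable_oppr.
rewrite integral_unit_exponential; last first.
  apply: (@measurable_bounded_integrable _ (measurableTypeR R) _ unit_exponential
    (fun e => gain s c (jump_step (stop_step s k e) x)) setT measurableT).
  - exact: le_lt_trans (probability_le1 unit_exponential measurableT) (ltry 1).
  - apply: measurableT_comp; first exact: measurable_gain.
    by apply: measurable_jump_step => //; exact: measurable_stop_step.
  - exists 1; split => // M M1 e _; rewrite /= ger0_norm ?gain_ge0//.
    by rewrite (le_trans (gain_le1 _ _ c1))// ltW.
rewrite (_ : (fun e => _) =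
  (fun e => (gain s c ((k - e) * x) * expR (- e))%:E) \_ `]0, k[); last first.
  apply/funext => e; rewrite patchE.
  have [|] := boolP (e \in `]0, k[%classic); rewrite /stop_step sk/=.
    rewrite inE/= in_itv/= => /andP[e0 ek]; rewrite e0 /jump_step x01.
    by rewrite exponential_pdfE ?ltW// mul1r mulN1r EFinM.
  rewrite notin_setE/= in_itv/= => /negP; rewrite negb_and -!leNgt => ke.
  have -> : gain s c (jump_step (if 0 < e then k - e else 0) x) = 0; last by rewrite mul0e.
  have : jump_step (if 0 < e then k - e else 0) x <= 0.
    rewrite /jump_step x01; case: ltP ke => [e0 /= ke|_ _]; last by rewrite mul0r.
    by rewrite mulr_le0_ge0 ?subr_le0 ?(ltW x0).
  move=> j0; rewrite /gain ltNge j0/= ltNge (le_trans j0)//; exact: ltW.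
rewrite -integral_mkcond.
rewrite (@itv_bndbnd_setU _ _ _ (BLeft (k - s))) ?bnd_simp; last 2 first.
- by rewrite subr_gt0.
- by rewrite gerBl ltW.
rewrite ge0_integral_setU//=; last 3 first.
- exact: measurable_funTS.
- by move=> e _; rewrite lee_fin mulr_ge0 ?gain_ge0 ?expR_ge0.
- apply/disj_setPS => e [] /=; rewrite !in_itv/= => /andP[_ +] /andP[+ _].
  by move=> /lt_le_trans /[apply]; rewrite ltxx.
congr (_ + _)%E.
transitivity (\int[leb]_(e in `[(k - s)%R, k[) (expR (- (1 - x) * e + - (k * x)))%:E)%E.
  apply: eq_integral => e; rewrite inE/= in_itv/= => /andP[kse ek].
  rewrite /gain ifT; first by rewrite -expRD; congr (expR _)%:E; ring.
  rewrite mulr_gt0 ?subr_gt0//=.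
  rewrite (@le_trans _ _ (k - e))//; first by rewrite ger_pMr ?subr_gt0// ltW.
  by rewrite lerBlDl addrC -lerBlDl.
rewrite integral_itv_bndo_bndc; last first.
  apply: measurable_funTS; apply/measurable_EFinP/measurableT_comp => //.
  by apply: measurable_funD => //; exact: measurable_funM.
rewrite integral_expR_affine; last 2 first.
- by rewrite oppr_eq0 subr_eq0 gt_eqF.
- by rewrite gtrBl.
rewrite /defect; congr EFin.
have -> : - (1 - x) * (k - s) - k * x = - k + s * (1 - x) by ring.
have -> : - (1 - x) * k - k * x = - k by ring.
rewrite expRD; field.
by rewrite subr_eq0 gt_eqF// -subr_eq0 opprB addrC subr_eq0 eqxx.
Qed.

Lemma integral_expRN (c a b : R) (b0 b1 : bool) : a < b ->
  (\int[leb]_(e in [set` Interval (BSide b0 a) (BSide b1 b)]) (c * expR (- e))%:E =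
   (c * (expR (- a) - expR (- b)))%:E)%E.
Proof.
move=> ab.
have mE : measurable_fun setT (fun e : R => expR (- e)) by exact: measurableT_comp.
have mcE D : measurable_fun D (fun e : R => (c * expR (- e))%:E).
  by apply: measurable_funTS; apply/measurable_EFinP/measurable_funM.
rewrite integral_itv_bndoo// -(@integral_itv_bndoo _ _ _ _ true false)//.
have iE : leb.-integrable `[a, b] (fun e : R => (expR (- e))%:E).
  apply: continuous_compact_integrable; first exact: segment_compact.
  by apply: continuous_subspaceT => e; apply: continuous_comp; [exact: cvgN|exact: continuous_expR].
under eq_integral do rewrite EFinM.
rewrite integralZl//.
have -> : (fun e : R => (expR (- e))%:E) = (fun e => (expR (- 1 * e + 0))%:E).
  by apply/funext => e; rewrite mulN1r addr0.
rewrite integral_expR_affine ?oppr_eq0// -EFinM !mulN1r !addr0.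
by congr EFin; field.
Qed.

Section integral_gain_bounds.
Variables (s k x : R).
Hypotheses (s0 : 0 < s) (sk : s < k) (x01 : 0 < x < 1).

Let measurable_gain_expR c D :
  measurable_fun D (fun e : R => (gain s c ((k - e) * x) * expR (- e))%:E).
Proof.
apply/measurable_funTS/measurable_EFinP/measurable_funM.
  apply: measurableT_comp; first exact: measurable_gain.
  by apply: measurable_funM => //; exact: measurable_funB.
exact: measurableT_comp.
Qed.

Let measurable_cst_expR c D : measurable_fun D (fun e : R => (c * expR (- e))%:E).
Proof.
apply/measurable_funTS/measurable_EFinP/measurable_funM => //.
exact: measurableT_comp.
Qed.

(** An early jump lands above [s x]: it either keeps the policy running, with value [c], or stops it
    with success probability below exp(- s x). *)
Lemma integral_gain_ub c : expR (- (s * x)) <= c <= 1 ->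
  (\int[unit_exponential]_e (gain s c (jump_step (stop_step s k e) x))%:E <=
   (c * (1 - expR (- (k - s))) + expR (- k) * defect s x)%:E)%E.
Proof.
move=> /andP[sxc c1]; have /andP[x0 x1] := x01.
have c0 : 0 <= c by exact: le_trans (expR_ge0 _) sxc.
rewrite integral_gain ?c0// EFinD leeD2r//.
have ks0 : 0 < k - s by rewrite subr_gt0.
have := integral_expRN c false true ks0; rewrite oppr0 expR0 => <-.
apply: ge0_le_integral => //.
- by move=> e _; rewrite lee_fin mulr_ge0 ?gain_ge0 ?expR_ge0.
- exact: measurable_gain_expR.
- exact: measurable_cst_expR.
- move=> e /=; rewrite in_itv/= => /andP[e0 eks].
  rewrite lee_fin ler_wpM2r ?expR_ge0// /gain; case: ifPn => [_|_]; last by case: ifP.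
  apply: le_trans sxc; rewrite ler_expR lerN2 ler_pM2r//.
  by rewrite lerBrDl -lerBrDr ltW.
Qed.

(** An early jump is worth exp(- s) if it stays above [s], and exp(- z) >= exp(- s) if it lands at
    [z] in ]0, s]. *)
Lemma integral_gain_lb : s < 1 ->
  ((expR (- s) * (1 - expR (- (k - s))) + expR (- k) * defect s x)%:E <
   \int[unit_exponential]_e (gain s (expR (- s)) (jump_step (stop_step s k e) x))%:E)%E.
Proof.
move=> s1; have /andP[x0 x1] := x01.
have es01 : 0 <= expR (- s) <= 1 by rewrite expR_ge0 -expR0 ler_expR oppr_le0 ltW.
rewrite integral_gain// EFinD lteD2rE//.
have ks0 : 0 < k - s by rewrite subr_gt0.
(* A jump by the factor x from a point between s and m ends below s (1 + x) / 2 < s: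
   this makes the inequality strict. *)
pose m := Num.min ((k + s) / 2) (s * (1 + x^-1) / 2).
have V1 : 1 < x^-1 by rewrite invf_gt1.
have sm : s < m.
  by rewrite lt_min; apply/andP; split; [lra|rewrite ltr_pdivlMr// ltr_pM2l//; lra].
have mk : m < k by rewrite gt_min; apply/orP; left; lra.
have mx : m * x <= s * (1 + x) / 2.
  have -> : s * (1 + x) / 2 = s * (1 + x^-1) / 2 * x by field; rewrite gt_eqF.
  by rewrite ler_pM2r// ge_min lexx orbT.
pose p := k - m; have p0 : 0 < p by rewrite subr_gt0.
have pks : p < k - s by rewrite ltrD2l ltrN2.
(* Waiting times before [p] bring at least exp(- s); those in [p, k - s[ leave at most [m] before
   the jump and bring at least [c'], which is larger. *)
rewrite (@itv_bndbnd_setU _ _ _ (BLeft p)) ?bnd_simp ?(ltW pks)//.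
rewrite ge0_integral_setU//=; last 3 first.
- exact: measurable_gain_expR.
- by move=> e _; rewrite lee_fin mulr_ge0 ?gain_ge0 ?expR_ge0//; case/andP: es01.
- apply/disj_setPS => e [] /=; rewrite !in_itv/= => /andP[_ +] /andP[+ _].
  by move=> /lt_le_trans /[apply]; rewrite ltxx.
pose c' := expR (- (s * (1 + x) / 2)).
have cc' : expR (- s) < c'.
  rewrite ltr_expR ltrN2; nra.
apply: (@lt_le_trans _ _ ((expR (- s) * (1 - expR (- p)))%:E +
    (c' * (expR (- p) - expR (- (k - s))))%:E)%E).
  rewrite -EFinD lte_fin.
  have -> : 1 - expR (- (k - s)) = (1 - expR (- p)) + (expR (- p) - expR (- (k - s))) by ring.
  by rewrite mulrDr ltrD2l ltr_pM2r// subr_gt0 ltr_expR ltrN2.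
apply: leeD.
- have := integral_expRN (expR (- s)) false true p0; rewrite oppr0 expR0 => <-.
  apply: ge0_le_integral => //.
  + exact: measurable_cst_expR.
  + exact: measurable_gain_expR.
  + move=> e /=; rewrite in_itv/= => /andP[e0 ep].
    rewrite lee_fin ler_wpM2r ?expR_ge0// /gain.
    have ekx0 : 0 < (k - e) * x.
      rewrite mulr_gt0// subr_gt0 (lt_trans ep)// /p gtrBl.
      exact: lt_trans sm.
    rewrite ekx0/=; case: leP => // h.
    by rewrite ler_expR lerN2.
- have := integral_expRN c' true true pks => <-.
  apply: ge0_le_integral => //.
  + by move=> e _; rewrite lee_fin mulr_ge0 ?expR_ge0.
  + exact: measurable_cst_expR.
  + exact: measurable_gain_expR.
  + move=> e /=; rewrite in_itv/= => /andP[pe eks].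
    rewrite lee_fin ler_wpM2r ?expR_ge0// /gain.
    have kem : k - e <= m by rewrite lerBlDr -lerBlDl.
    have ekx : (k - e) * x <= s * (1 + x) / 2.
      by apply: le_trans mx; rewrite ler_pM2r.
    rewrite ifT.
      by rewrite ler_expR lerN2.
    rewrite mulr_gt0//=; last by rewrite subr_gt0 (lt_trans eks)// gtrBl.
    apply: (le_trans ekx); nra.
Qed.

End integral_gain_bounds.

End exponential_law.

(** * The threshold *)

(** If the integral of the positive function [g - f] were 0, it would vanish almost everywhere on
    [D], and [D] would be a null set. *)
Lemma lt_integral d (T : measurableType d) {R : realType}
    (mu : {measure set T -> \bar R}) (D : set T) (f g : T -> \bar R) :
  measurable D -> mu D != 0%E ->
  measurable_fun D f -> measurable_fun D g ->
  (forall x, D x -> 0 <= f x)%E -> (forall x, D x -> f x < g x)%E ->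
  (\int[mu]_(x in D) f x < +oo)%E ->
  (\int[mu]_(x in D) f x < \int[mu]_(x in D) g x)%E.
Proof.
move=> mD muD mf mg f0 fg foo.
have ffin x : D x -> f x \is a fin_num.
  by move=> Dx; rewrite fin_numElt (lt_le_trans _ (f0 x Dx))//= (lt_le_trans (fg x Dx))// leey.
have mgf : measurable_fun D (fun x => g x - f x)%E by exact: emeasurable_funB.
have gf0 x : D x -> (0 < g x - f x)%E.
  by move=> Dx; rewrite sube_gt0 fg.
have -> : (\int[mu]_(x in D) g x = \int[mu]_(x in D) f x + \int[mu]_(x in D) (g x - f x))%E.
  rewrite -ge0_integralD//.
    apply: eq_integral => x /[!inE] Dx; rewrite addeC subeK//; exact: ffin.
  by move=> x Dx; exact/ltW/gf0.
have If0 : (0 <= \int[mu]_(x in D) f x)%E by exact: integral_ge0.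
rewrite lteDl; last by rewrite ge0_fin_numE.
rewrite lt0e integral_ge0 ?andbT; last by move=> x Dx; exact/ltW/gf0.
apply/eqP => I0; move/eqP: muD; apply.
have : (\int[mu]_(x in D) `|g x - f x| = 0)%E.
  by rewrite -[RHS]I0; apply: eq_integral => x /[!inE] Dx; rewrite gee0_abs// ltW// gf0.
move/(ae_eq_integral_abs mu mD mgf) => [N [mN N0 DN]].
apply: (subset_measure0 mD mN _ N0) => x Dx; apply: DN => /= /(_ Dx) h.
by have := gf0 x Dx; rewrite h ltxx.
Qed.

Lemma measurable_invr {R : realType} : measurable_fun setT (fun x : R => x^-1).
Proof.
rewrite -(setUv [set (0 : R)]); apply/measurable_funU => //.
  exact: measurableC.
split; first exact: measurable_fun_set1.
apply: open_continuous_measurable_fun.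
  exact/closed_openC/(compact_closed (@norm_hausdorff _ R))/compact_set1.
move=> x /[!inE]/= /eqP x0; exact: cvgV.
Qed.

Section threshold.
Context {R : realType} (mu : probability R R).
Hypothesis mu01 : mu `]0%R, 1%R[%classic = 1%E.
Local Notation D := (`]0%R, 1%R[%classic : set R).

Lemma integral_unit_interval (f : R -> \bar R) :
  measurable_fun [set: R] f -> (forall x, 0 <= f x)%E ->
  (\int[mu]_x f x = \int[mu]_(x in D) f x)%E.
Proof.
move=> mf f0.
have mD : measurable D by exact: measurable_itv.
have N0 : mu (~` D) = 0%E by rewrite probability_setC// mu01 subee.
rewrite (ge0_negligible_integral (measurableC mD) measurableT mf _ N0)//.
by rewrite setTD setCK.
Qed.

Lemma measurable_defect (s : R) A : measurable_fun A (defect s).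
Proof.
apply: measurable_funTS; apply: measurable_funM.
  apply: measurable_funB => //; apply: measurableT_comp => //.
  by apply: measurable_funM => //; exact: measurable_funB.
by apply: measurableT_comp; [exact: measurable_invr|exact: measurable_funB].
Qed.

Lemma lt_defect (s x : R) : 0 < s -> x < 1 -> s < defect s x.
Proof.
move=> s0 x1; rewrite /defect ltr_pdivlMr ?subr_gt0// ltrBrDl.
by apply: expR_gt1Dx; rewrite mulf_neq0 ?gt_eqF// subr_gt0.
Qed.

Lemma ltr_defect (s t x : R) : s < t -> x < 1 -> defect s x < defect t x.
Proof.
move=> st x1; rewrite /defect ltr_pM2r ?invr_gt0 ?subr_gt0// ltrD2r.
by rewrite ltr_expR ltr_pM2r// subr_gt0.
Qed.

(** For [b <= a] this is the tangent inequality exp(b - a) >= 1 + (b - a) multiplied by exp(a). *)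
Lemma ler_norm_expRB (a b : R) : `|expR a - expR b| <= `|a - b| * expR (Num.max a b).
Proof.
wlog ba : a b / b <= a.
  move=> h; have /orP[/h//|ab] := le_total b a.
  by rewrite distrC (distrC a) maxC; exact: h.
rewrite (max_idPl ba) !ger0_norm ?subr_ge0 ?ler_expR//.
have := expR_ge1Dx (b - a); rewrite -(ler_pM2l (expR_gt0 a)) -expRD.
have -> : a + (b - a) = b by ring.
rewrite mulrDr mulr1; lra.
Qed.

(** The factor [1 - x] in the exponents cancels the denominator, so the constant does not depend on
    [x]; this yields integrability of [defect s] and continuity of its mean in [s]. *)
Lemma lipschitz_defect (s t x : R) : 0 < x < 1 ->
  `|defect t x - defect s x| <= `|t - s| * expR (Num.max `|t| `|s|).
Proof.
move=> /andP[x0 x1]; rewrite /defect -mulrBl.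
have y0 : 0 < 1 - x by rewrite subr_gt0.
rewrite normrM (gtr0_norm (x := _^-1)) ?invr_gt0// ler_pdivrMr//.
have -> : expR (t * (1 - x)) - 1 - (expR (s * (1 - x)) - 1) =
  expR (t * (1 - x)) - expR (s * (1 - x)) by ring.
apply: le_trans (ler_norm_expRB _ _) _.
rewrite -mulrBl normrM (gtr0_norm y0) mulrAC ler_pM2r// ler_wpM2l// ler_expR.
have aux u : u * (1 - x) <= `|u|.
  apply: le_trans (ler_norm _) _; rewrite normrM (gtr0_norm y0).
  by rewrite ler_piMr// gerBl ltW.
by rewrite ge_max !le_max !aux orbT.
Qed.

(** For [x > 1] numerator and denominator are both nonpositive. The sign on the whole line allows
    the expectation to be restricted to ]0, 1[. *)
Lemma defect_ge0 (s x : R) : 0 <= s -> 0 <= defect s x.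
Proof.
move=> s0; rewrite /defect; have [x1|x1] := leP x 1.
  by rewrite divr_ge0 ?subr_ge0// -[leLHS]expR0 ler_expR mulr_ge0// subr_ge0.
by rewrite mulr_le0// ?invr_le0 subr_le0 ?(ltW x1)// -[leRHS]expR0 ler_expR
  mulr_ge0_le0// subr_le0 ltW.
Qed.

Let mD : measurable D. Proof. exact: measurable_itv. Qed.
Let muD : mu D != 0%E. Proof. by rewrite mu01 onee_neq0. Qed.

Lemma integral_cstD (c : \bar R) : (\int[mu]_(x in D) cst c x = c)%E.
Proof. by rewrite integral_cst// -[RHS]mule1 -mu01. Qed.

Let integrable_defect s : mu.-integrable D (EFin \o defect s).
Proof.
apply: (@measurable_bounded_integrable _ _ _ mu) => //.
- exact: le_lt_trans (probability_le1 mu mD) (ltry 1).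
- exact: measurable_defect.
- exists (`|s| * expR `|s|); split => // M sM x /= x01.
  apply: le_trans (ltW sM).
  have := lipschitz_defect 0 s x01; rewrite {2}/defect mul0r expR0 subrr mul0r !subr0 normr0.
  by rewrite (max_idPl _).
Qed.

Let g s := \int[mu]_(x in D) defect s x.

Let gE s : (\int[mu]_(x in D) (defect s x)%:E = (g s)%:E)%E.
Proof. by rewrite /g /Rintegral fineK//; exact: integrable_fin_num (integrable_defect s). Qed.

Lemma is_thresholdE s : is_threshold mu s <-> 0 < s /\ (\int[mu]_(x in D) (defect s x)%:E = 1)%E.
Proof.
rewrite /is_threshold unlock.
split=> -[s0]; rewrite integral_unit_interval.
- by [].
- apply/measurable_EFinP; exact: measurable_defect.
- by move=> x; rewrite lee_fin; exact/defect_ge0/ltW.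
- by [].
- apply/measurable_EFinP; exact: measurable_defect.
- by move=> x; rewrite lee_fin; exact/defect_ge0/ltW.
Qed.

Let continuous_g : continuous g.
Proof.
move=> s; apply/cvgrPdist_le => eps eps0.
(* [M] dominates the Lipschitz constants of [lipschitz_defect] for all [t] within distance 1 of
   [s]. *)
pose M := expR (`|s| + 1); have M0 : 0 < M by exact: expR_gt0.
near=> t.
have ts1 : `|t - s| <= 1.
  near: t; by apply: (cvgr_distC_le id s); [exact: cvg_id|exact: ltr01].
have tse : `|t - s| <= eps / M.
  near: t; by apply: (cvgr_distC_le id s); [exact: cvg_id|exact: divr_gt0].
rewrite distrC /g -RintegralB//; try exact: integrable_defect.
have iB : mu.-integrable D (EFin \o (fun x => defect t x - defect s x)).
  exact: (integrableB mD (integrable_defect t) (integrable_defect s)).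
apply: le_trans (le_normr_Rintegral mD iB) _.
have -> : eps = \int[mu]_(x in D) (cst eps x).
  by rewrite Rintegral_cst// (congr1 fine mu01 : fine (mu D) = 1) mulr1.
apply: le_Rintegral => //.
- exact: integrable_norm iB.
- exact: finite_measure_integrable_cst.
- move=> x x01; apply: le_trans (lipschitz_defect _ _ x01) _.
  rewrite -ler_pdivlMr ?expR_gt0//; apply: le_trans tse _.
  rewrite ler_wpM2l ?(ltW eps0)// lef_pV2 ?posrE ?expR_gt0// ler_expR.
  rewrite ge_max ?lerDl ?ler01 ?andbT.
  by rewrite -(subrK s t) (le_trans (ler_normD _ _))// addrC lerD2l.
Unshelve. all: by end_near. Qed.

(** By [lt_defect] the integrand exceeds [s] on ]0, 1[, while its mean is 1. *)
Lemma is_threshold_lt1 s : is_threshold mu s -> s < 1.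
Proof.
move=> /is_thresholdE[s0 s1]; rewrite -lte_fin -s1 -[ltLHS]integral_cstD.
apply: lt_integral => //.
- apply/measurable_EFinP; exact: measurable_defect.
- by move=> x _; rewrite lee_fin ltW.
- by move=> x /=; rewrite in_itv/= => /andP[_ x1]; rewrite lte_fin lt_defect.
- by rewrite integral_cstD ltry.
Qed.

(** The mean of [defect s] is strictly increasing and continuous in [s], vanishes at 0 and is at
    least 1 at [s = 1]. *)
Lemma threshold_unique : exists! s, is_threshold mu s.
Proof.
have inc s t : is_threshold mu s -> is_threshold mu t -> s < t -> False.
  move=> /is_thresholdE[s0 s1] /is_thresholdE[t0 t1] st.
  suff : (1 < 1 :> \bar R)%E by rewrite ltxx.
  rewrite -{1}s1 -t1; apply: lt_integral => //.
  - apply/measurable_EFinP; exact: measurable_defect.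
  - apply/measurable_EFinP; exact: measurable_defect.
  - by move=> x _; rewrite lee_fin; exact/defect_ge0/ltW.
  - by move=> x /=; rewrite in_itv/= => /andP[_ x1]; rewrite lte_fin ltr_defect.
  - by rewrite s1 ltry.
have g0 : g 0 = 0.
  apply: EFin_inj; rewrite -gE; apply: integral0_eq => x _.
  by rewrite /defect mul0r expR0 subrr mul0r.
have g1 : 1 <= g 1.
  rewrite -lee_fin -gE -[leLHS]integral_cstD.
  apply: ge0_le_integral => //.
  - apply/measurable_EFinP; exact: measurable_defect.
  - by move=> x /=; rewrite in_itv/= => /andP[_ x1]; rewrite lee_fin ltW// lt_defect.
have [||s] := @IVT R g 0 1 1 ler01.
- exact: continuous_subspaceT.
- by rewrite g0 (min_idPl _) ?(le_trans ler01 g1)// (max_idPr _) ?(le_trans ler01 g1)// ler01.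
rewrite in_itv/= => /andP[s0 _] gs.
have ths : is_threshold mu s.
  apply/is_thresholdE; rewrite gE gs; split => //.
  rewrite lt_neqAle s0 andbT; apply: contra_eq_neq gs => <-.
  by rewrite g0 eq_sym oner_neq0.
exists s; split => // t tht.
by case: (ltgtP s t) => // [/(inc _ _ ths tht)|/(inc _ _ tht ths)].
Qed.

End threshold.

Section unit_exponential_law.
Context {R : realType}.

Definition exponential_law : probability R R := distribution (@unit_exponential R) (@to_real R).

Lemma integral_exponential_law (f : R -> \bar R) :
  measurable_fun [set: R] f -> (forall x, 0 <= f x)%E ->
  (\int[exponential_law]_e f e = \int[unit_exponential]_e f e)%E.
Proof. by move=> mf f0; rewrite ge0_integral_distribution. Qed.

End unit_exponential_law.

(** * One step of the chain, averaged over the factor and the waiting time *)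

Section gain_after_step.
Context {R : realType} (mu : probability R R).

(** The waiting time is integrated inside, so that the inner integral is the one computed in
    [integral_gain] for a fixed factor. *)
Definition next_gain (s c k : R) : \bar R :=
  (\int[mu]_x \int[exponential_law]_e
     (gain s c (jump_step (stop_step s k e) x))%:E)%E.

Let measurable_step (s c k : R) :
  measurable_fun [set: R * R] (fun z : R * R =>
    (gain s c (jump_step (stop_step s k z.2) z.1))%:E).
Proof.
apply/measurable_EFinP/measurableT_comp; first exact: measurable_gain.
by apply: measurable_jump_step => //; exact: measurable_stop_step.
Qed.

Let measurable_stepE (s c k x : R) :
  measurable_fun [set: R] (fun e : R => (gain s c (jump_step (stop_step s k e) x))%:E).
Proof. exact: measurable_fun_pair2 (measurable_step s c k). Qed.

Let measurable_inner (s c k : R) : 0 <= c ->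
  measurable_fun [set: R] (fun x : R =>
   \int[exponential_law]_e (gain s c (jump_step (stop_step s k e) x))%:E)%E.
Proof.
move=> c0.
apply: (measurable_fun_fubini_tonelli_F (m2 := exponential_law) _ (measurable_step s c k)).
by move=> z; rewrite lee_fin gain_ge0.
Qed.

Lemma measurable_integral_step (s : R) (f : R -> \bar R) :
  measurable_fun [set: R] f -> (forall z, 0 <= f z)%E ->
  measurable_fun [set: R] (fun k : R => \int[mu]_x \int[exponential_law]_e
    f (jump_step (stop_step s k e) x))%E.
Proof.
move=> mf f0.
have m3 : measurable_fun [set: (R * R) * R] (fun z : (R * R) * R =>
    f (jump_step (stop_step s z.1.1 z.2) z.1.2)).
  apply: measurableT_comp => //; apply: measurable_jump_step; last first.
    exact: measurableT_comp.
  by apply: measurable_stop_step => //; exact: measurableT_comp.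
have m2 := measurable_fun_fubini_tonelli_F (m2 := exponential_law) _ m3 (fun=> f0 _).
apply: (measurable_fun_fubini_tonelli_F (m2 := mu) _ m2) => z.
exact: integral_ge0.
Qed.

(** The chain moves on to 0, where the gain vanishes: a stop is counted once. *)
Lemma next_gain_stopped (s c k : R) : 0 < s -> k <= s -> next_gain s c k = 0%E.
Proof.
move=> s0 ks; rewrite /next_gain; apply: integral0_eq => x _; apply: integral0_eq => e _.
rewrite /stop_step ltNge ks/= /jump_step mul0r if_same /gain ltxx/=.
by rewrite ltNge (ltW s0).
Qed.

Lemma next_gain_lb (s k : R) : mu `]0%R, 1%R[%classic = 1%E -> is_threshold mu s -> s < k ->
  ((expR (- s))%:E < next_gain s (expR (- s)) k)%E.
Proof.
move=> mu01 ths sk; have s1 := is_threshold_lt1 mu01 ths.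
have /(is_thresholdE mu01)[s0 intd] := ths.
have mD : measurable (`]0%R, 1%R[%classic : set R) by exact: measurable_itv.
rewrite /next_gain (integral_unit_interval mu01); last 2 first.
- by apply: measurable_inner; exact: expR_ge0.
- by move=> x; apply: integral_ge0 => e _; rewrite lee_fin gain_ge0// expR_ge0.
(* [low] is the pointwise bound of [integral_gain_lb]. As [defect s] has mean 1, its own mean is
   exp(- s) - exp(- k) + exp(- k) = exp(- s). *)
pose low x := (expR (- s) * (1 - expR (- (k - s))) + expR (- k) * defect s x)%:E.
have q0 : 0 <= expR (- s) * (1 - expR (- (k - s))).
  by rewrite mulr_ge0 ?expR_ge0// subr_ge0 -[leRHS]expR0 ler_expR oppr_le0 subr_ge0 ltW.
have mdef : measurable_fun (`]0%R, 1%R[%classic : set R) (fun x => (expR (- k) * defect s x)%:E).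
  by apply/measurable_EFinP/measurable_funM => //; exact: measurable_defect.
have muD : mu `]0%R, 1%R[%classic != 0%E by rewrite mu01 onee_neq0.
have lowE : (\int[mu]_(x in `]0%R, 1%R[) low x = (expR (- s))%:E)%E.
  rewrite /low; under eq_integral do rewrite EFinD.
  rewrite ge0_integralD//; last first.
    by move=> x _; rewrite lee_fin mulr_ge0 ?expR_ge0// defect_ge0// ltW.
  rewrite integral_cstD//.
  under eq_integral do rewrite EFinM.
  rewrite ge0_integralZl_EFin ?expR_ge0//; last 2 first.
  - by move=> x _; rewrite lee_fin defect_ge0// ltW.
  - by apply/measurable_EFinP; exact: measurable_defect.
  rewrite intd mule1 -EFinD mulrBr mulr1 -expRD.
  by congr EFin; rewrite (_ : - s + - (k - s) = - k) ?subrK//; ring.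
rewrite -lowE; apply: lt_integral => //.
- apply/measurable_EFinP/measurable_funD => //; apply: measurable_funM => //.
  exact: measurable_defect.
- by apply: measurable_funTS; apply: measurable_inner; exact: expR_ge0.
- by move=> x _; rewrite lee_fin addr_ge0// mulr_ge0 ?expR_ge0// defect_ge0// ltW.
- move=> x /=; rewrite in_itv/= => x01.
  rewrite integral_exponential_law//; last by move=> e; rewrite lee_fin gain_ge0// expR_ge0.
  exact: integral_gain_lb.
- by rewrite lowE ltry.
Qed.

(** Put c = exp(- s x) and q = exp(- (k - s)). The bound c (1 - q) + exp(- k) [defect s x] is at
    most c (1 - q) + exp(- s) q, hence at most c. *)
Lemma next_gain_ub (s k x : R) : mu =1 \d_x -> 0 < x < 1 -> 0 < s -> s < k ->
  defect s x <= 1 ->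
  (next_gain s (expR (- (s * x))) k <= (expR (- (s * x)))%:E)%E.
Proof.
move=> mux x01 s0 sk ds; have /andP[x0 x1] := x01.
pose c := expR (- (s * x)); have c0 : 0 <= c by exact: expR_ge0.
have c1 : c <= 1 by rewrite -[leRHS]expR0 ler_expR oppr_le0 mulr_ge0 ?ltW.
rewrite /next_gain (eq_measure_integral \d_x); last by move=> A _ _; exact: mux.
rewrite integral_dirac//; last exact: measurable_inner.
rewrite diracT mul1e integral_exponential_law//; last by move=> e; rewrite lee_fin gain_ge0.
apply: le_trans (integral_gain_ub s0 sk x01 _) _; first by rewrite lexx c1.
have : expR (- k) * defect s x <= c * expR (- (k - s)).
  have -> : expR (- k) = expR (- s) * expR (- (k - s)).
    by rewrite -expRD; congr expR; ring.
  rewrite -mulrA [expR (- (k - s)) * _]mulrC mulrA ler_pM2r ?expR_gt0//.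
  apply: le_trans (_ : expR (- s) <= c).
    by rewrite ler_piMr ?expR_ge0.
  by rewrite ler_expR lerN2 ler_piMr ?ltW.
by rewrite lee_fin -/c mulrBr mulr1; lra.
Qed.

End gain_after_step.

(** * The value of the policy *)

Section record_chain.
Context {R : realType} (mu : probability R R) d (Omega : measurableType d)
  (P : probability Omega R) (X E : nat -> {RV P >-> R}).
Hypotheses (mu01 : mu `]0%R, 1%R[%classic = 1%E) (XE : record_inputs mu X E).
Variables (T s : R).
Hypotheses (s0 : 0 < s) (sT : s < T).

(** The order E_0, X_0, E_1, X_1, ... in which the chain consumes its inputs: [chain_at n] uses the
    first [n.*2] of them. *)
Definition interleave (i : nat) : Omega -> R := if odd i then X i./2 else E i./2.

Definition chain_at (n : nat) (w : Omega) : R :=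
  chain T s (fun j => X j w) (fun j => E j w) n.

Let mX j : measurable_fun setT (X j). Proof. exact: measurable_funPT. Qed.
Let mE j : measurable_fun setT (E j). Proof. exact: measurable_funPT. Qed.

Let XmuE j A : measurable A -> P (X j @^-1` A) = mu A.
Proof. by move=> mA; case: XE => + _ _ => /(_ j A mA). Qed.

Let EexpE j A : measurable A -> P (E j @^-1` A) = exponential_law A.
Proof. by move=> mA; case: XE => _ + _ => /(_ j A mA). Qed.

Lemma measurable_chain_at n : measurable_fun setT (chain_at n).
Proof.
elim: n => [|n IH]; first exact: measurable_cst.
by apply: measurable_jump_step => //; exact: measurable_stop_step.
Qed.

Let code (i : nat) : nat + nat := if odd i then inl i./2 else inr i./2.
Let decode (i : nat + nat) : nat := match i with inl j => j.*2.+1 | inr j => j.*2 end.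
Let codeK : cancel code decode.
Proof.
by move=> i; rewrite /code; case: ifP => oi /=; rewrite -[RHS]odd_double_half oi.
Qed.

Lemma interleave_indep (A : nat -> set R) N : (forall i, measurable (A i)) ->
  P (\big[setI/setT]_(i < N) (interleave i @^-1` A i)) =
  (\prod_(i < N) P (interleave i @^-1` A i))%E.
Proof.
move=> mA; case: XE => _ _ indep.
pose Y (i : nat + nat) : {RV P >-> R} := match i with inl j => X j | inr j => E j end.
have YE i : Y (code i) = interleave i :> (Omega -> R).
  by rewrite /code /interleave; case: ifP.
pose J : {fset nat + nat} := seq_fset tt (map code (iota 0 N)).
have pJ : perm_eq J (map code (iota 0 N)).
  apply: uniq_perm; first exact: fset_uniq.
  - by rewrite map_inj_uniq ?iota_uniq//; exact: can_inj codeK.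
  - by move=> i; rewrite seq_fsetE.
have H := indep J (A \o decode) (fun i => mA _).
have -> : (\prod_(i < N) P (interleave i @^-1` A i) =
    \prod_(i <- J) P (Y i @^-1` A (decode i)))%E.
  rewrite (perm_big _ pJ)/= big_map.
  have -> : iota 0 N = index_iota 0 N by rewrite /index_iota subn0.
  by rewrite big_mkord; apply: eq_bigr => i _; rewrite codeK YE.
rewrite -H; congr (P _); rewrite -(bigcap_mkord N (fun i => interleave i @^-1` A i)).
apply/seteqP; split => w /= h i.
- rewrite /= (perm_mem pJ) => /mapP[j]; rewrite mem_iota/= => jN -> /=.
  by have := h j jN; rewrite codeK -/(Y _) YE.
- move=> iN; have := h (code i); rewrite -/(Y _) /= YE codeK; apply.
  by rewrite (perm_mem pJ) map_f// mem_iota.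
Qed.

Lemma interleave_E n : interleave (n.*2 + 0) = E n.
Proof. by rewrite addn0 /interleave odd_double doubleK. Qed.

Lemma interleave_X n : interleave (n.*2 + 1) = X n.
Proof. by rewrite addn1 /interleave/= odd_double/= uphalf_double. Qed.

(** [indep_future_step] absorbs one input, so a step of the chain is cut after E_n; the half step
    also gives the independence from X_n used in [integral_chain_step]. *)
Lemma indep_future_chain_half n :
  indep_future P (chain_at n) (fun i => interleave (n.*2 + i)) ->
  indep_future P (fun w => stop_step s (chain_at n w) (E n w))
    (fun i => interleave (n.*2 + i.+1)).
Proof.
move=> IH; rewrite -interleave_E.
apply: (indep_future_step (f := fun z => stop_step s z.1 z.2) (m := exponential_law)) IH => //.
- exact: measurable_chain_at.
- exact: measurable_stop_step.
- by move=> A mA; rewrite interleave_E EexpE.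
Qed.

Lemma indep_future_chain n :
  indep_future P (chain_at n) (fun i => interleave (n.*2 + i)).
Proof.
elim: n => [A C N mA mC|n IH].
  rewrite /chain_at/= preimage_cst; case: ifP => _.
    by rewrite setTI probability_setT mul1e interleave_indep.
  by rewrite set0I measure0 mul0e.
have : indep_future P (fun w => jump_step (stop_step s (chain_at n w) (E n w))
    (interleave (n.*2 + 1) w)) (fun i => interleave (n.*2 + i.+2)).
  apply: (indep_future_step (f := fun z => jump_step z.1 z.2) (m := mu))
    (indep_future_chain_half IH) => //.
  - by apply: measurable_stop_step => //; exact: measurable_chain_at.
  - exact: measurable_jump_step.
  - by move=> A mA; rewrite interleave_X XmuE.
rewrite interleave_X; congr indep_future; apply/funext => i.
by rewrite doubleS !addSnnS.
Qed.

Lemma chain_at_indep_E n A B : measurable A -> measurable B ->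
  P (chain_at n @^-1` A `&` E n @^-1` B) = (P (chain_at n @^-1` A) * exponential_law B)%E.
Proof.
move=> mA mB; rewrite -(EexpE n)// -[in LHS]interleave_E.
by rewrite (indep_future_pair (@indep_future_chain n))// interleave_E.
Qed.

(** The Markov property: X_n is integrated out first, then E_n, and Tonelli restores the order of
    [next_gain]. *)
Lemma integral_chain_step (f : R -> \bar R) n :
  measurable_fun [set: R] f -> (forall z, 0 <= f z)%E ->
  (\int[P]_w f (chain_at n.+1 w) = \int[P]_w \int[mu]_x \int[exponential_law]_e
     f (jump_step (stop_step s (chain_at n w) e) x))%E.
Proof.
move=> mf f0.
have mj : measurable_fun [set: R * R] (fun z => f (jump_step z.1 z.2)).
  by apply: measurableT_comp => //; exact: measurable_jump_step.
have mstop : measurable_fun setT (fun w => stop_step s (chain_at n w) (E n w)).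
  by apply: measurable_stop_step => //; exact: measurable_chain_at.
transitivity (\int[P]_w \int[mu]_x f (jump_step (stop_step s (chain_at n w) (E n w)) x))%E.
  apply: (@integral_joint1 _ _ _ _ _ _ _ P mu _ _ mstop (mX n) _
    (fun z => f (jump_step z.1 z.2))) => //.
  move=> A B mA mB; rewrite -(XmuE n)// -[in LHS]interleave_X.
  have := indep_future_chain_half (@indep_future_chain n).
  by move=> /indep_future_pair -> //; rewrite interleave_X.
pose H z := (\int[mu]_x f (jump_step (stop_step s z.1 z.2) x))%E.
have mH : measurable_fun [set: R * R] H.
  apply: (measurable_fun_fubini_tonelli_F (m2 := mu)
    (fun z : (R * R) * R => f (jump_step (stop_step s z.1.1 z.1.2) z.2))) => //.
  apply: measurableT_comp => //; apply: measurable_jump_step => //.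
  by apply: measurable_stop_step; exact: measurableT_comp.
transitivity (\int[P]_w \int[exponential_law]_e H (chain_at n w, e))%E.
  apply: (integral_joint1 (@measurable_chain_at n) (mE n) _ mH).
  - exact: chain_at_indep_E.
  - by move=> z; exact: integral_ge0.
apply: eq_integral => w _.
rewrite /H/= (fubini_tonelli (fun z => f (jump_step (stop_step s (chain_at n w) z.1) z.2)))//.
apply: measurableT_comp => //; apply: measurable_jump_step => //.
exact: measurable_stop_step.
Qed.

Definition win n : set Omega := [set w | 0 < chain_at n w <= s /\ chain_at n w < E n w].

Let measurable_running n : measurable [set w | (s < chain_at n w)%R].
Proof.
have := @measurable_chain_at n measurableT `]s, +oo[%classic (measurable_itv _).
by rewrite setTI; congr measurable; apply/seteqP; split => w /=; rewrite in_itv/= andbT.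
Qed.

Let win_fun (z : R * R) : bool := (0 < z.1 <= s) && (z.1 < z.2).

Let measurable_win_fun : measurable_fun [set: R * R] win_fun.
Proof.
apply: measurable_and; last exact: measurable_fun_ltr.
by apply: measurable_and; [apply: measurable_fun_ltr|apply: measurable_fun_ler].
Qed.

Lemma measurable_win n : measurable (win n).
Proof.
have mZ : measurable_fun setT (fun w => (chain_at n w, E n w)).
  by apply: measurable_fun_pair => //; exact: measurable_chain_at.
have := measurableT_comp measurable_win_fun mZ measurableT (Y := [set true]) I.
by rewrite setTI; congr measurable; apply/seteqP; split => w /= /andP.
Qed.

Lemma prob_win n : P (win n) = (\int[P]_w
  (if (0 < chain_at n w <= s)%R then (expR (- chain_at n w))%:E else 0%E))%E.
Proof.
pose f (z : R * R) := (if win_fun z then 1%:E else 0%E : \bar R).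
have mf : measurable_fun setT f by exact: measurable_fun_ifT.
have f0 z : (0 <= f z)%E by rewrite /f; case: ifP.
transitivity (\int[P]_w f (chain_at n w, E n w))%E.
  rewrite -[win n]setIT -integral_indic//; last exact: measurable_win.
  apply: eq_integral => w _; rewrite indicE /f /win_fun/=.
  case: ifPn => h; first by rewrite mem_set//; exact/andP.
  by rewrite memNset// => /andP; exact/negP.
rewrite (integral_joint1 (@measurable_chain_at n) (mE n) (@chain_at_indep_E n) mf f0).
apply: eq_integral => w _; case: ifPn => h; last first.
  by apply: integral0_eq => e _; rewrite /f /win_fun/= (negbTE h).
have /andP[/ltW k0 _] := h.
transitivity (exponential_law `]chain_at n w, +oo[%classic); last exact: unit_exponential_gt k0.
rewrite -[X in exponential_law X]setIT -integral_indic//.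
apply: eq_integral => e _; rewrite indicE /f /win_fun/= h/=.
case: ifPn => he; first by rewrite mem_set//= in_itv/= he.
by rewrite memNset//= in_itv/= andbT; exact/negP.
Qed.

(** The first case of [gain] integrates to [P (win n)] by [prob_win], its second case to the
    weighted probability of still running. *)
Lemma integral_gain_chain c n : 0 <= c ->
  (\int[P]_w (gain s c (chain_at n w))%:E =
   P (win n) + c%:E * P [set w | (s < chain_at n w)%R])%E.
Proof.
move=> c0; rewrite prob_win -[X in (c%:E * P X)%E]setIT -integral_indic//.
have mk := @measurable_chain_at n.
have mkN : measurable_fun setT (fun w => expR (- chain_at n w)).
  by apply: measurableT_comp => //; exact: measurableT_comp.
have m1 : measurable_fun setT (fun w => if (0 < chain_at n w <= s)%R
    then (expR (- chain_at n w))%:E else 0%E : \bar R).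
  apply: measurable_fun_ifT => //; last exact/measurable_EFinP.
  by apply: measurable_and; [apply: measurable_fun_ltr|apply: measurable_fun_ler].
have m2 : measurable_fun setT (fun w => (\1_[set w | (s < chain_at n w)%R] w)%:E : \bar R).
  by apply/measurable_EFinP; exact: measurable_indic.
rewrite -ge0_integralZl_EFin//.
rewrite -ge0_integralD//; last 3 first.
- by move=> w _; case: ifP => // _; rewrite lee_fin expR_ge0.
- by move=> w _; rewrite mule_ge0// lee_fin.
- exact: measurable_funeM.
apply: eq_integral => w _; rewrite /gain; case: ifPn => [/andP[_ ks]|h].
  by rewrite indicE memNset/= ?mule0 ?adde0//; apply/negP; rewrite -leNgt.
rewrite add0e -EFinM indicE; case: ifPn => sk; first by rewrite mem_set//= mulr1.
by rewrite memNset/= ?mulr0//; exact/negP.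
Qed.

(** Running on requires [E n <= T], an event of probability 1 - exp(- T) independent of the chain at
    time [n]. *)
Lemma prob_running_le n :
  (P [set w | (s < chain_at n w)%R] <= ((1 - expR (- T)) ^+ n)%:E)%E.
Proof.
have T0 := lt_trans s0 sT.
elim: n => [|n IH]; first by rewrite expr0 probability_le1.
apply: (@le_trans _ _ (P (chain_at n @^-1` `]s, +oo[ `&` E n @^-1` `]-oo, T]))).
  apply: le_measure; rewrite ?inE//; last first.
    move=> w /= /(chain_running s0)[sk ek]; rewrite !in_itv/= andbT; split => //.
    exact/ltW/(lt_le_trans ek)/chain_le.
  apply: measurableI.
    by rewrite -[_ @^-1` _]setTI; exact: measurable_chain_at.
  by rewrite -[_ @^-1` _]setTI; exact: mE.
have eT : exponential_law `]-oo, T]%classic = (1 - expR (- T))%:E.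
  exact: unit_exponential_le (ltW T0).
rewrite chain_at_indep_E// eT exprSr EFinM lee_wpmul2r//.
  by rewrite lee_fin subr_ge0 -[leRHS]expR0 ler_expR oppr_le0 ltW.
by move: IH; congr (P _ <= _)%E; apply/seteqP; split => w /=; rewrite in_itv/= andbT.
Qed.

Lemma trivIset_win : trivIset setT win.
Proof.
apply/trivIsetP => m n _ _; wlog mn : m n / (m < n)%N.
  move=> h; rewrite neq_ltn => /orP[mn|nm]; last rewrite setIC; apply: h => //.
    by rewrite ltn_eqF.
  by rewrite ltn_eqF.
move=> _; apply/seteqP; split => // w [[/andP[_ km] _] [/andP[kn _] _]].
have kn0 := chain_absorbing (T := T) (x := fun j => X j w) (e := fun j => E j w) s0 mn km.
by move: kn; rewrite /chain_at kn0 ltxx.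
Qed.

Let bad : set Omega := \bigcup_j
  ((X j @^-1` ~` `]0%R, 1%R[%classic) `|` (E j @^-1` `]-oo, 0%R]%classic)).

Let bad0 : measurable bad /\ P bad = 0%E.
Proof.
have mN01 : measurable (~` `]0%R, 1%R[%classic : set R).
  by apply: measurableC; exact: measurable_itv.
have mj j : measurable ((X j @^-1` ~` `]0%R, 1%R[%classic) `|` (E j @^-1` `]-oo, 0%R]%classic)).
  by apply: measurableU; apply: measurable_preimage => //; exact: measurable_itv.
have mbad : measurable bad by exact: bigcupT_measurable.
split => //; apply: measure_negligible => //; apply: negligible_bigcup => j.
apply/(negligibleP P (mj j)).
have PX : P (X j @^-1` ~` `]0%R, 1%R[%classic) = 0%E.
  by rewrite XmuE// probability_setC ?mu01 ?subee//; exact: measurable_itv.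
have PE : P (E j @^-1` `]-oo, 0%R]%classic) = 0%E.
  rewrite EexpE; last exact: measurable_itv.
  have := @unit_exponential_le R 0 (lexx 0); rewrite oppr0 expR0 subrr; exact.
rewrite -PX; apply: measureU0 => //; first exact: measurable_preimage.
by apply: measurable_preimage => //; exact: measurable_itv.
Qed.

(** The event of [value] is exactly the union of the [win n] minus the null event [bad] on which
    some input leaves its range; this also shows that it is measurable. *)
Lemma value_bigcup_win : value X E T s = P (\bigcup_n win n).
Proof.
have [mbad Pbad] := bad0.
have mwin : measurable (\bigcup_n win n) by apply: bigcupT_measurable => n; exact: measurable_win.
rewrite (_ : P (\bigcup_n win n) = P ((\bigcup_n win n) `\` bad)); last first.
  rewrite (measureDI P mwin mbad) [X in (_ + X)%E](_ : _ = 0%E) ?adde0//.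
  by apply: (subset_measure0 _ mbad _ Pbad); [exact: measurableI|exact: subIsetr].
congr (P _); apply/seteqP; split => w.
- move=> [Xw Ew /(recognises_last_chain Xw Ew s0 sT)[n kn]]; split; first by exists n.
  move=> [j _ [/=|/=]]; first by rewrite in_itv/= Xw.
  by rewrite in_itv/= leNgt Ew.
- move=> [[n _ kn] good].
  have Xw j : 0 < X j w < 1.
    by apply: contrapT => h; apply: good; exists j => //; left; rewrite /= in_itv.
  have Ew j : 0 < E j w.
    rewrite ltNge; apply/negP => h; apply: good; exists j => //; right.
    by rewrite /= in_itv.
  by split => //; apply/(recognises_last_chain Xw Ew s0 sT); exists n.
Qed.

Lemma next_gain_running c (n : nat) : 0 <= c ->
  (P (win n.+1) + c%:E * P [set w | (s < chain_at n.+1 w)%R] =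
   \int[P]_w next_gain mu s c (chain_at n w))%E.
Proof.
move=> c0; rewrite -integral_gain_chain//.
rewrite (@integral_chain_step (fun z => (gain s c z)%:E))//.
- by apply/measurable_EFinP; exact: measurable_gain.
- by move=> z; rewrite lee_fin gain_ge0.
Qed.

Let integral_running c n : 0 <= c ->
  (\int[P]_w (c%:E * (\1_[set w | (s < chain_at n w)%R] w)%:E) =
   c%:E * P [set w | (s < chain_at n w)%R])%E.
Proof.
move=> c0; rewrite ge0_integralZl_EFin//; last first.
  by apply/measurable_EFinP; exact: measurable_indic.
by rewrite integral_indic// setIT.
Qed.

Let measurable_next_gain c n : 0 <= c ->
  measurable_fun setT (fun w => next_gain mu s c (chain_at n w)).
Proof.
move=> c0; apply: (measurableT_comp _ (measurable_chain_at n)).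
apply: (measurable_integral_step mu s (f := fun z => (gain s c z)%:E)).
- by apply/measurable_EFinP; exact: measurable_gain.
- by move=> z; rewrite lee_fin gain_ge0.
Qed.

Let win0 : P (win 0) = 0%E.
Proof.
rewrite (_ : win 0 = set0) ?measure0//; apply/seteqP; split => // w [/andP[_]].
by rewrite /chain_at/= leNgt sT.
Qed.

Let running0 : P [set w | (s < chain_at 0 w)%R] = 1%E.
Proof.
by rewrite (_ : [set w | _] = setT) ?probability_setT//; apply/seteqP; split.
Qed.

(** If no running state is worth more than [c] after one step, then P(success by step N) + [c]
    P(running at step N) does not increase; it starts at [c], and its second term is nonnegative. *)
Lemma value_ub c : 0 <= c -> (forall k, s < k -> (next_gain mu s c k <= c%:E)%E) ->
  (value X E T s <= c%:E)%E.
Proof.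
move=> c0 ngc.
have step n : (P (win n.+1) + c%:E * P [set w | (s < chain_at n.+1 w)%R] <=
    c%:E * P [set w | (s < chain_at n w)%R])%E.
  rewrite next_gain_running// -integral_running//; apply: ge0_le_integral => //.
  - by move=> w _; apply: integral_ge0 => x _; apply: integral_ge0 => e _; rewrite lee_fin gain_ge0.
  - exact: measurable_next_gain.
  - by apply: measurable_funeM; apply/measurable_EFinP; exact: measurable_indic.
  - move=> w _; have [ks|sk] := leP (chain_at n w) s.
      by rewrite next_gain_stopped// mule_ge0.
    by rewrite indicE mem_set//= mule1; exact: ngc.
have sum_le N : (\sum_(0 <= i < N.+1) P (win i) +
    c%:E * P [set w | (s < chain_at N w)%R] <= c%:E)%E.
  elim: N => [|n IH]; first by rewrite big_nat1 win0 add0e running0 mule1.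
  rewrite big_nat_recr//= -addeA; apply: le_trans IH.
  exact: leeD2l (step n).
rewrite value_bigcup_win measure_semi_bigcup//; last 3 first.
- by move=> n; exact: measurable_win.
- exact: trivIset_win.
- by apply: bigcupT_measurable => n; exact: measurable_win.
apply: lime_le; first exact: is_cvg_nneseries.
apply: nearW => N; apply: le_trans (sum_le N).
by rewrite big_nat_recr//= -addeA leeDl// adde_ge0// mule_ge0.
Qed.

Lemma value_lb : is_threshold mu s -> ((expR (- s))%:E < value X E T s)%E.
Proof.
move=> ths; pose c := expR (- s); have c0 : 0 <= c by exact: expR_ge0.
have c1 : c <= 1 by rewrite -[leRHS]expR0 ler_expR oppr_le0 ltW.
have step n : (c%:E * P [set w | (s < chain_at n w)%R] <=
    P (win n.+1) + c%:E * P [set w | (s < chain_at n.+1 w)%R])%E.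
  rewrite next_gain_running// -integral_running//; apply: ge0_le_integral => //.
  - by move=> w _; rewrite mule_ge0// lee_fin.
  - by apply: measurable_funeM; apply/measurable_EFinP; exact: measurable_indic.
  - exact: measurable_next_gain.
  - move=> w _; have [ks|sk] := leP (chain_at n w) s.
      rewrite next_gain_stopped// indicE memNset/= ?mule0//.
      by apply/negP; rewrite -leNgt.
    by rewrite indicE mem_set//= mule1; exact/ltW/next_gain_lb.
(* Strict inequalities are lost in the limit, so the surplus is fixed once, at the deterministic
   start [T]: later steps preserve the bound [L], and [L > c]. *)
pose L := (P (win 1) + c%:E * P [set w | (s < chain_at 1 w)%R])%E.
have cL : (c%:E < L)%E.
  rewrite /L next_gain_running//.
  have -> : (\int[P]_w next_gain mu s c (chain_at 0 w) = next_gain mu s c T)%E.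
    by rewrite -[RHS]mule1 -(probability_setT P) -integral_cst.
  exact: next_gain_lb.
have sumL n : (L <= \sum_(0 <= i < n.+2) P (win i) +
    c%:E * P [set w | (s < chain_at n.+1 w)%R])%E.
  elim: n => [|n IH]; first by rewrite !big_nat_recr//= big_nil win0 !add0e.
  rewrite big_nat_recr//= -addeA; apply: (le_trans IH).
  exact: leeD2l (step n.+1).
set V := value X E T s.
have LV n : (L <= V + ((1 - expR (- T)) ^+ n.+1)%:E)%E.
  apply: le_trans (sumL n) _; apply: leeD.
    rewrite /V value_bigcup_win measure_semi_bigcup//.
    - exact: nneseries_lim_ge.
    - by move=> i; exact: measurable_win.
    - exact: trivIset_win.
    - by apply: bigcupT_measurable => i; exact: measurable_win.
  apply: le_trans (prob_running_le _); rewrite -[leRHS]mul1e lee_wpmul2r//.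
apply: lt_le_trans cL _.
have Vfin : V \is a fin_num.
  rewrite /V value_bigcup_win fin_num_measure//.
  by apply: bigcupT_measurable => i; exact: measurable_win.
have qlt1 : `|1 - expR (- T)| < 1.
  have T0 := lt_trans s0 sT.
  rewrite ger0_norm ?gtrBl ?expR_gt0// subr_ge0 -[leRHS]expR0 ler_expR oppr_le0.
  exact: ltW.
apply/lee_addgt0Pr => eps eps0.
have /cvgrPdist_lt/(_ eps eps0)[N _ HN] := cvg_expr qlt1.
apply: le_trans (LV N) _; rewrite leeD2l// lee_fin.
have := HN N.+1 (leqnSn N); rewrite /= sub0r normrN.
by move=> /ltW; apply: le_trans; exact: ler_norm.
Qed.

End record_chain.

(** * Independent exponential variables on the unit interval *)

(** With equal finite total mass the values on the complementary rays ]t, +oo[ agree too; these form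
    a generating class stable under intersection. *)
Lemma eq_measure_rays {R : realType} (m1 m2 : {measure set R -> \bar R}) :
  (m1 setT < +oo)%E -> m1 setT = m2 setT ->
  (forall t, m1 `]-oo, t]%classic = m2 `]-oo, t]%classic) ->
  forall A, measurable A -> m1 A = m2 A.
Proof.
move=> m1T m12T m12.
have ray (m : {measure set R -> \bar R}) t : (m setT < +oo)%E ->
    m `]t, +oo[%classic = (m setT - m `]-oo, t]%classic)%E.
  move=> mT; rewrite -setCitvl -setTD measureD ?setTI//; exact: measurable_itv.
have roo t : (m1 `]t, +oo[%classic < +oo)%E.
  by apply: le_lt_trans m1T; apply: le_measure; rewrite ?inE//; exact: measurable_itv.
move=> A mA.
apply: (measure_unique (@RGenOInfty.G R) (fun n => `](- n%:R), +oo[%classic)) => //.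
- exact: (RGenOInfty.measurableE R).
- move=> _ _ [x ->] [y ->]; exists (Num.max x y).
  by apply/seteqP; split => z /=; rewrite !in_itv/= !andbT gt_max => /andP.
- by move=> n; exists (- n%:R).
- apply/seteqP; split => // x _; exists (Num.truncn `|x|).+1 => //=.
  rewrite in_itv/= andbT ltrNl; apply: le_lt_trans (truncnS_gt _).
  by rewrite -normrN ler_norm.
- by move=> _ [t ->]; rewrite !ray// ?m12T ?m12// -m12T.
Qed.

Section uniform01.
Context {R : realType}.

Definition uniform01 : probability R R := distribution (uniform_prob (@ltr01 R)) (@to_real R).

Lemma uniform01E (A : set R) : measurable A ->
  uniform01 A = lebesgue_measure (A `&` `[0, 1]%classic).
Proof.
move=> mA; rewrite -[LHS]/(uniform_prob (@ltr01 R) A) /uniform_prob integral_uniform_pdf.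
have mA01 : measurable (A `&` `[0, 1]%classic : set (measurableTypeR R)).
  by apply: measurableI => //; exact: measurable_itv.
transitivity (\int[lebesgue_measure]_(x in A `&` `[0%R, 1%R]) (cst 1%:E x))%E.
  apply: eq_integral => x; rewrite inE/= in_itv/= => -[_ x01].
  by rewrite /uniform_pdf x01 subr0 invr1.
by rewrite integral_cst//= mul1e.
Qed.

Lemma uniform01_itv (A : set R) (a b : R) (b0 b1 : bool) : measurable A ->
  A `&` `[0, 1]%classic = [set` Interval (BSide b0 a) (BSide b1 b)] -> a <= b ->
  uniform01 A = (b - a)%:E.
Proof.
move=> mA AE ab; rewrite uniform01E// AE lebesgue_measure_itv/= lte_fin.
by case: ltgtP ab => // -> _; rewrite subrr.
Qed.

Lemma uniform01_le (t : R) : 0 <= t <= 1 -> uniform01 `]-oo, t]%classic = t%:E.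
Proof.
move=> /andP[t0 t1]; rewrite (@uniform01_itv _ 0 t true false)// ?subr0//.
apply/seteqP; split => x /=; rewrite !in_itv/=.
  by move=> [xt /andP[-> _]].
by move=> /andP[-> xt]; split => //=; exact: le_trans t1.
Qed.

Lemma uniform01_lt0 (A : set R) : measurable A -> A `<=` [set t | t < 0] -> uniform01 A = 0%E.
Proof.
move=> mA A0; rewrite uniform01E// (_ : _ `&` _ = set0) ?measure0//.
apply/seteqP; split => // x [/A0 /= x0]; rewrite in_itv/= => /andP[].
by rewrite leNgt x0.
Qed.

Lemma uniform01_1 (A : set R) : measurable A -> `[0, 1]%classic `<=` A -> uniform01 A = 1%E.
Proof.
move=> mA A1; rewrite (@uniform01_itv _ 0 1 true false) ?subr0//.
by rewrite setIidr.
Qed.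

(** On [0, 1], the event that the first binary digit is 0; its complement stands for the digit 1. *)
Definition low_half : set R := `]-oo, (1 / 2)[%classic.

Lemma measurable_low_half : measurable low_half.
Proof. exact: measurable_itv. Qed.

(** A distribution function test for [f] being uniform and independent of [H]. It serves for
    doubling on either half and, later, for each of the two digit sequences. *)
Lemma uniform01_setI (k : R) (f : R -> R) (H : set R) : 0 <= k ->
  measurable_fun setT f -> measurable H ->
  (forall t, uniform01 (H `&` f @^-1` `]-oo, t]%classic) =
    (k%:E * uniform01 `]-oo, t]%classic)%E) ->
  uniform01 H = k%:E ->
  forall C, measurable C -> uniform01 (H `&` f @^-1` C) = (k%:E * uniform01 C)%E.
Proof.
move=> k0 mf mH rays PH C mC; rewrite setIC.
pose m1 : {measure set R -> \bar R} :=
  measure_function_pushforward__canonical__measure_function_Measure (mrestr uniform01 mH) mf.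
pose m2 : {measure set R -> \bar R} := mscale (NngNum k0) uniform01.
apply: (@eq_measure_rays _ m1 m2) => //.
- by rewrite /= /pushforward /mrestr preimage_setT setTI PH ltry.
- rewrite /= /pushforward /mrestr /mscale preimage_setT setTI PH/=.
  by rewrite -[LHS]mule1 -(probability_setT uniform01).
- by move=> t; rewrite /= /pushforward /mrestr /mscale/= setIC rays.
Qed.

Lemma uniform01_low_half (C : set R) : measurable C ->
  uniform01 (low_half `&` (fun w => 2 * w) @^-1` C) = ((1 / 2)%:E * uniform01 C)%E.
Proof.
apply: uniform01_setI; first lra.
- exact: measurable_funM.
- exact: measurable_low_half.
- move=> t; set A := _ `&` _.
  have mA : measurable A.
    apply: measurableI; first exact: measurable_low_half.
    by rewrite -[_ @^-1` _]setTI; apply: measurable_funM => //; exact: measurable_itv.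
  have mt : measurable (`]-oo, t]%classic : set R) by exact: measurable_itv.
  have AP x : A x <-> x < 1 / 2 /\ 2 * x <= t by rewrite /A /low_half/= !in_itv.
  have [t0|t0] := ltP t 0.
    rewrite !uniform01_lt0 ?mule0//.
      by move=> x /=; rewrite in_itv/= => xt; exact: le_lt_trans t0.
    by move=> x /AP /=; lra.
  have [t1|t1] := ltP t 1.
    rewrite uniform01_le ?t0 ?ltW// -EFinM (@uniform01_itv _ 0 (t / 2) true false)//.
    + by congr EFin; lra.
    + apply/seteqP; split => x /=; rewrite !in_itv/=.
        by move=> [/AP[_ xt] /andP[-> _]] /=; lra.
      move=> /andP[x0 xt]; split; first by apply/AP; lra.
      by rewrite x0/=; lra.
    + lra.
  have P1 : uniform01 `]-oo, t]%classic = 1%E.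
    by apply: uniform01_1 => // x /=; rewrite !in_itv/= => /andP[_]; lra.
  rewrite P1 mule1.
  rewrite (@uniform01_itv _ 0 (1 / 2) true true) ?subr0//.
  apply/seteqP; split => x /=; rewrite !in_itv/=.
    by move=> [/AP[xt _] /andP[-> _]] /=; lra.
  move=> /andP[x0 xt]; split; first by apply/AP; lra.
  by rewrite x0/=; lra.
- rewrite (@uniform01_itv _ 0 (1 / 2) true true) ?subr0//; first exact: measurable_low_half.
  apply/seteqP; split => x /=; rewrite !in_itv/=.
    by move=> [xt /andP[-> _]].
  by move=> /andP[x0 xt]; split => //; rewrite x0/=; lra.
Qed.

Lemma uniform01_high_half (C : set R) : measurable C ->
  uniform01 (~` low_half `&` (fun w => 2 * w - 1) @^-1` C) = ((1 / 2)%:E * uniform01 C)%E.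
Proof.
have mhigh : measurable (~` low_half) by apply: measurableC; exact: measurable_low_half.
have mf : measurable_fun [set: R] (fun w : R => 2 * w - 1).
  by apply: measurable_funB => //; exact: measurable_funM.
have highP x : (~` low_half) x <-> 1 / 2 <= x.
  by rewrite /low_half /= in_itv/=; split => [/negP|h]; [rewrite -leNgt|apply/negP; rewrite -leNgt].
apply: uniform01_setI => //.
- move=> t; set A := _ `&` _.
  have mA : measurable A.
    apply: measurableI => //.
    by rewrite -[_ @^-1` _]setTI; apply: mf => //; exact: measurable_itv.
  have mt : measurable (`]-oo, t]%classic : set R) by exact: measurable_itv.
  have AP x : A x <-> 1 / 2 <= x /\ 2 * x - 1 <= t.
    by rewrite -highP /A/= in_itv.
  have [t0|t0] := ltP t 0.
    have P0 : uniform01 `]-oo, t]%classic = 0%E.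
      by apply: uniform01_lt0 => // x /=; rewrite in_itv/= => xt; exact: le_lt_trans t0.
    rewrite P0 mule0 (_ : A = set0) ?measure0//.
    by apply/seteqP; split => // x /AP; lra.
  have [t1|t1] := ltP t 1.
    rewrite uniform01_le ?t0 ?ltW// -EFinM.
    rewrite (@uniform01_itv _ (1 / 2) ((1 + t) / 2) true false)//.
    + by congr EFin; lra.
    + apply/seteqP; split => x /=; rewrite !in_itv/=.
        by move=> [/AP[-> xt] _] /=; lra.
      move=> /andP[x0 xt]; split; first by apply/AP; lra.
      by apply/andP; split; lra.
    + lra.
  have P1 : uniform01 `]-oo, t]%classic = 1%E.
    by apply: uniform01_1 => // x /=; rewrite !in_itv/= => /andP[_]; lra.
  rewrite P1 mule1.
  rewrite (@uniform01_itv _ (1 / 2) 1 true false)//; last lra.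
    by congr EFin; lra.
  apply/seteqP; split => x /=; rewrite !in_itv/=.
    by move=> [/AP[-> _] /andP[_ ->]].
  move=> /andP[x0 xt]; split; first by apply/AP; lra.
  by rewrite xt andbT; lra.
- rewrite (@uniform01_itv _ (1 / 2) 1 true false)//; last lra.
    by congr EFin; lra.
  apply/seteqP; split => x /=; rewrite !in_itv/=.
    by move=> [/highP xt /andP[_ ->]]; rewrite xt.
  by move=> /andP[x0 xt]; split; [exact/highP|rewrite xt andbT; lra].
Qed.

Definition doubling (w : R) : R := if w < 1 / 2 then 2 * w else 2 * w - 1.

Definition first_bit (w : R) : R := if w < 1 / 2 then 0 else 1.

(** [doubling] deletes the first binary digit, so each round reads one digit and skips the next;
    replacing the remaining digits by 0 makes the sequence nondecreasing in [n]. *)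
Fixpoint even_bits_approx (n : nat) (w : R) : R :=
  if n is m.+1 then (first_bit w + even_bits_approx m (doubling (doubling w))) / 2 else 0.

(* The number whose binary digits are those of [w] of index 0, 2, 4, ... *)
Definition even_bits (w : R) : R := limn (even_bits_approx ^~ w).

Definition odd_bits (w : R) : R := even_bits (doubling w).

Lemma first_bit_itv w : 0 <= first_bit w <= 1.
Proof. by rewrite /first_bit; case: ifP => _; rewrite ?lexx ?ler01. Qed.

Lemma even_bits_approx_itv n w : 0 <= even_bits_approx n w <= 1.
Proof.
elim: n w => [|n IH] w /=; first by rewrite lexx ler01.
have := first_bit_itv w; have := IH (doubling (doubling w)); lra.
Qed.

Lemma even_bits_approx_le n w : even_bits_approx n w <= even_bits_approx n.+1 w.
Proof.
elim: n w => [|n IH] w; first by case/andP: (even_bits_approx_itv 1 w).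
rewrite [leLHS]/= [leRHS]/=.
have := IH (doubling (doubling w)); rewrite [X in _ <= X -> _]/=; lra.
Qed.

Lemma cvg_even_bits w : even_bits_approx ^~ w @ \oo --> even_bits w.
Proof.
apply: nondecreasing_is_cvgn.
  by apply/nondecreasing_seqP => n; exact: even_bits_approx_le.
by exists 1 => _ [n _ <-]; case/andP: (even_bits_approx_itv n w).
Qed.

Lemma even_bitsE w : even_bits w = (first_bit w + odd_bits (doubling w)) / 2.
Proof.
apply/cvg_lim => //; rewrite -(cvg_shiftS _).
apply: cvgM; last exact: cvg_cst.
by apply: cvgD; [exact: cvg_cst|exact: cvg_even_bits].
Qed.

Lemma even_bits_itv w : 0 <= even_bits w <= 1.
Proof.
apply/andP; split.
- apply: limr_ge; first by apply/cvg_ex; exists (even_bits w); exact: cvg_even_bits.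
  by apply: nearW => n; case/andP: (even_bits_approx_itv n w).
- apply: limr_le; first by apply/cvg_ex; exists (even_bits w); exact: cvg_even_bits.
  by apply: nearW => n; case/andP: (even_bits_approx_itv n w).
Qed.

Lemma odd_bits_itv w : 0 <= odd_bits w <= 1.
Proof. exact: even_bits_itv. Qed.

Lemma measurable_doubling : measurable_fun setT doubling.
Proof.
apply: measurable_fun_ifT => //.
- by apply: measurable_fun_ltr.
- by apply: measurable_funB => //; exact: measurable_funM.
Qed.

Lemma measurable_first_bit : measurable_fun setT first_bit.
Proof. by apply: measurable_fun_ifT => //; apply: measurable_fun_ltr. Qed.

Lemma measurable_even_bits : measurable_fun setT even_bits.
Proof.
apply: (measurable_fun_cvg (h := even_bits_approx)); last by move=> w _; exact: cvg_even_bits.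
elim=> [|n IH]; first exact: measurable_cst.
apply: measurable_funM => //; apply: measurable_funD; first exact: measurable_first_bit.
by apply: measurableT_comp => //; apply: measurableT_comp; exact: measurable_doubling.
Qed.

Lemma measurable_odd_bits : measurable_fun setT odd_bits.
Proof. by apply: measurableT_comp; [exact: measurable_even_bits|exact: measurable_doubling]. Qed.

Let joint (a b : R) : set R := [set w | even_bits w <= a /\ odd_bits w <= b].

Let measurable_joint a b : measurable (joint a b).
Proof.
rewrite (_ : joint a b = even_bits @^-1` `]-oo, a]%classic `&` odd_bits @^-1` `]-oo, b]%classic).
  apply: measurableI; rewrite -[_ @^-1` _]setTI.
    by apply: measurable_even_bits => //; exact: measurable_itv.
  by apply: measurable_odd_bits => //; exact: measurable_itv.
by apply/seteqP; split => w; rewrite /joint/= !in_itv.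
Qed.

(* Doubling exchanges even and odd digits, whence the two functional equations [F_low] and
   [F_high] below.  The function [a * b] satisfies them as well, and they halve the
   difference of two solutions, so [F a b = a * b]. *)
Let F a b := fine (uniform01 (joint a b)).

Let FE a b : uniform01 (joint a b) = (F a b)%:E.
Proof. by rewrite /F fineK// fin_num_measure. Qed.

Let F_itv a b : 0 <= F a b <= 1.
Proof.
by rewrite -!lee_fin -FE measure_ge0 probability_le1.
Qed.

Let F11 : F 1 1 = 1.
Proof.
apply: EFin_inj; rewrite -FE -(probability_setT uniform01).
congr (uniform01 _); apply/seteqP; split => // w _; split.
  by case/andP: (even_bits_itv w).
by case/andP: (odd_bits_itv w).
Qed.

Let bits_low w : w < 1 / 2 ->
  even_bits w = odd_bits (2 * w) / 2 /\ odd_bits w = even_bits (2 * w).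
Proof.
move=> w2; have dE : doubling w = 2 * w by rewrite /doubling w2.
by split; [rewrite even_bitsE /first_bit w2 add0r dE|rewrite /odd_bits dE].
Qed.

Let bits_high w : 1 / 2 <= w ->
  even_bits w = (1 + odd_bits (2 * w - 1)) / 2 /\ odd_bits w = even_bits (2 * w - 1).
Proof.
rewrite leNgt => /negbTE w2; have dE : doubling w = 2 * w - 1 by rewrite /doubling w2.
by split; [rewrite even_bitsE /first_bit w2 dE|rewrite /odd_bits dE].
Qed.

(** A first digit 1 would make [even_bits w] at least 1/2, so only the low half contributes, and
    there doubling exchanges the two constraints. *)
Let F_low a b : 0 <= a -> a < 1 / 2 -> F a b = F b (2 * a) / 2.
Proof.
move=> a0 a1; apply: EFin_inj; rewrite -FE mulrC EFinM -FE -[2^-1]div1r -uniform01_low_half//.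
congr (uniform01 _); apply/seteqP; split => w; rewrite /joint/= /low_half/= in_itv/=.
- move=> [h1 h2]; have [w2|w2] := ltP w (1 / 2).
    by move: h1 h2; have [-> ->] := bits_low w2; do ?split => //; lra.
  by have [e _] := bits_high w2; have := odd_bits_itv (2 * w - 1); lra.
- move=> [w2 [h1 h2]]; have [-> ->] := bits_low w2; split => //; lra.
Qed.

(** On the low half [even_bits w <= 1/2 <= a] always holds, which leaves the vacuous bound 1 in
    [F b 1]; the high half gives the second term. *)
Let F_high a b : 1 / 2 <= a -> a <= 1 -> F a b = (F b 1 + F b (2 * a - 1)) / 2.
Proof.
move=> a0 a1; apply: EFin_inj; rewrite -FE.
transitivity ((1 / 2)%:E * uniform01 (joint b 1) +
    (1 / 2)%:E * uniform01 (joint b (2 * a - 1)))%E; last first.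
  by rewrite !FE -!EFinM -EFinD; congr EFin; ring.
rewrite -uniform01_low_half// -uniform01_high_half//.
have mlow := @measurable_low_half.
have m1 : measurable (low_half `&` (fun w => 2 * w) @^-1` joint b 1).
  by apply: measurableI => //; rewrite -[_ @^-1` _]setTI; exact: measurable_funM.
have m2 : measurable (~` low_half `&` (fun w => 2 * w - 1) @^-1` joint b (2 * a - 1)).
  apply: measurableI; first exact: measurableC.
  rewrite -[_ @^-1` _]setTI; apply: measurable_funB => //; exact: measurable_funM.
rewrite -measureU//; last first.
  by rewrite setIACA setICr set0I.
congr (uniform01 _); apply/seteqP; split => w; rewrite /joint/= /low_half/= in_itv/=.
- move=> [h1 h2]; have [w2|w2] := ltP w (1 / 2).
    left; split => //; move: h1 h2; have [-> ->] := bits_low w2 => _ ->; split => //.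
    by case/andP: (odd_bits_itv (2 * w)).
  right; split; first by [].
  by move: h1 h2; have [-> ->] := bits_high w2; do ?split => //; lra.
- move=> [[w2 [h1 h2]]|[/negP w2 [h1 h2]]].
    by have [-> ->] := bits_low w2; split => //; have := odd_bits_itv (2 * w); lra.
  move: w2; rewrite -leNgt => w2.
  by have [-> ->] := bits_high w2; split => //; lra.
Qed.

Let contraction (u : R) : (forall n, `|u| <= (1 / 2) ^+ n) -> u = 0.
Proof.
move=> h; apply/eqP; rewrite -normr_le0.
have /cvg_lim <-// : (1 / 2 : R) ^+ n @[n --> \oo] --> 0.
  by apply: cvg_expr; rewrite ger0_norm; lra.
apply: limr_ge; first by apply/cvg_ex; exists 0; apply: cvg_expr; rewrite ger0_norm; lra.
exact: nearW.
Qed.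

(** At [a = 1] the two terms of [F_high] coincide. *)
Let F1 t : F 1 t = F t 1.
Proof. rewrite F_high ?lexx//; last lra. by rewrite (_ : 2 * 1 - 1 = 1); lra. Qed.

(** Settled before the product formula because [F_high] contains [F b 1]. By [F1] the recursion
    closes in one variable, and each round halves the distance to the solution [t]. *)
Let F_right t : 0 <= t <= 1 -> F t 1 = t.
Proof.
move=> t01; apply/eqP; rewrite -subr_eq0; apply/eqP/contraction => n.
elim: n t t01 => [|n IH] t t01.
  by rewrite expr0 ler_norml; have := F_itv t 1; lra.
rewrite exprS; case/andP: t01 => t0 t1; have [t2|t2] := ltP t (1 / 2).
  rewrite F_low// F1 (_ : _ - t = (F (2 * t) 1 - 2 * t) / 2); last by field.
  have := IH (2 * t); rewrite !ler_norml; lra.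
rewrite F_high// F11 F1 (_ : _ - t = (F (2 * t - 1) 1 - (2 * t - 1)) / 2); last by field.
have := IH (2 * t - 1); rewrite !ler_norml; lra.
Qed.

Let FM a b : 0 <= a <= 1 -> 0 <= b <= 1 -> F a b = a * b.
Proof.
move=> a01 b01; apply/eqP; rewrite -subr_eq0; apply/eqP/contraction => n.
elim: n a b a01 b01 => [|n IH] a b a01 b01.
  have := F_itv a b; have : 0 <= a * b <= 1.
    by case/andP: a01 => a0 a1; case/andP: b01 => b0 b1; rewrite mulr_ge0// mulr_ile1.
  by rewrite expr0 ler_norml; lra.
rewrite exprS; case/andP: (a01) => a0 a1; have [a2|a2] := ltP a (1 / 2).
  rewrite F_low// (_ : _ - a * b = (F b (2 * a) - b * (2 * a)) / 2); last by field.
  have := IH b (2 * a) b01; rewrite !ler_norml; lra.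
rewrite F_high// (F_right b01).
rewrite (_ : _ - a * b = (F b (2 * a - 1) - b * (2 * a - 1)) / 2); last by field.
have := IH b (2 * a - 1) b01; rewrite !ler_norml; lra.
Qed.

Let joint_rays a b : uniform01 (joint a b) =
  (uniform01 `]-oo, a]%classic * uniform01 `]-oo, b]%classic)%E.
Proof.
have mray t : measurable (`]-oo, t]%classic : set R) by exact: measurable_itv.
have ray0 t : t < 0 -> uniform01 `]-oo, t]%classic = 0%E.
  by move=> t0; apply: uniform01_lt0 => // x /=; rewrite in_itv/= => xt; exact: le_lt_trans t0.
have ray1 t : 1 <= t -> uniform01 `]-oo, t]%classic = 1%E.
  by move=> t1; apply: uniform01_1 => // x /=; rewrite !in_itv/= => /andP[_]; lra.
have [a0|a0] := ltP a 0.
  rewrite ray0// mul0e (_ : joint a b = set0) ?measure0//.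
  by apply/seteqP; split => // w [+ _]; have := even_bits_itv w; lra.
have [b0|b0] := ltP b 0.
  rewrite (ray0 b)// mule0 (_ : joint a b = set0) ?measure0//.
  by apply/seteqP; split => // w [_]; have := odd_bits_itv w; lra.
(* Both digit numbers are at most 1, so a bound beyond 1 may be lowered to 1. *)
wlog a1 : a a0 / a <= 1.
  move=> h; have [|a1] := leP a 1; first exact: h.
  rewrite ray1 ?ltW// -(ray1 1)// -h//.
  congr (uniform01 _); apply/seteqP; split => w [h1 h2]; split => //.
  - by case/andP: (even_bits_itv w).
  - by have := even_bits_itv w; lra.
wlog b1 : b b0 / b <= 1.
  move=> h; have [|b1] := leP b 1; first exact: h.
  rewrite (ray1 b) ?ltW// -(ray1 1)// -h//.
  congr (uniform01 _); apply/seteqP; split => w [h1 h2]; split => //.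
  - by case/andP: (odd_bits_itv w).
  - by have := odd_bits_itv w; lra.
by rewrite FE FM ?a0 ?b0// !uniform01_le ?a0 ?b0.
Qed.

(** [uniform01_setI] is applied twice: rays become Borel sets first for the even digits with a ray
    of odd digits fixed, then for the odd digits with [A] fixed. *)
Lemma even_odd_bits_law A B : measurable A -> measurable B ->
  uniform01 (even_bits @^-1` A `&` odd_bits @^-1` B) = (uniform01 A * uniform01 B)%E.
Proof.
move=> mA mB.
have mray t : measurable (`]-oo, t]%classic : set R) by exact: measurable_itv.
have jointE a b : joint a b =
    even_bits @^-1` `]-oo, a]%classic `&` odd_bits @^-1` `]-oo, b]%classic.
  by apply/seteqP; split => w; rewrite /joint/= !in_itv.
have fink C : measurable C -> uniform01 C = (fine (uniform01 C))%:E.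
  by move=> mC; rewrite fineK// fin_num_measure.
have me := measurable_even_bits; have mo := measurable_odd_bits.
have ray1 : uniform01 `]-oo, 1]%classic = 1%E.
  by apply: uniform01_1 => // x /=; rewrite !in_itv/= => /andP[_].
have evenray b C : measurable C ->
    uniform01 (odd_bits @^-1` `]-oo, b]%classic `&` even_bits @^-1` C) =
    (uniform01 `]-oo, b]%classic * uniform01 C)%E.
  move=> mC; rewrite (fink `]-oo, b]%classic)//; apply: uniform01_setI => //.
  - by rewrite fine_ge0.
  - exact: measurable_preimage.
  - by move=> t; rewrite setIC -jointE joint_rays -fink// muleC.
  - rewrite -fink// -[RHS]mul1e -ray1 -joint_rays jointE; congr (uniform01 _).
    rewrite [X in X `&` _](_ : _ = setT) ?setTI//; apply/seteqP; split => // w _.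
    by rewrite /= in_itv/=; case/andP: (even_bits_itv w).
rewrite (fink A)//; apply: uniform01_setI => //.
- by rewrite fine_ge0.
- exact: measurable_preimage.
- by move=> t; rewrite setIC evenray// -fink// muleC.
- rewrite -fink// -[RHS]mul1e -ray1 -evenray//; congr (uniform01 _).
  rewrite [X in X `&` _](_ : _ = setT) ?setTI//; apply/seteqP; split => // w _.
  by rewrite /= in_itv/=; case/andP: (odd_bits_itv w).
Qed.

Lemma odd_bits_law B : measurable B -> uniform01 (odd_bits @^-1` B) = uniform01 B.
Proof.
move=> mB; have := even_odd_bits_law measurableT mB.
by rewrite preimage_setT setTI probability_setT mul1e.
Qed.

Lemma even_bits_law A : measurable A -> uniform01 (even_bits @^-1` A) = uniform01 A.
Proof.
move=> mA; have := even_odd_bits_law mA measurableT.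
by rewrite preimage_setT setIT probability_setT mule1.
Qed.

(** Each term takes the even digits of what the previous terms left over and passes on the odd
    ones. *)
Definition uniform_seq (j : nat) (w : R) : R := even_bits (iter j odd_bits w).

Lemma measurable_uniform_seq j : measurable_fun setT (uniform_seq j).
Proof.
apply: measurableT_comp; first exact: measurable_even_bits.
elim: j => [|j IH]; first exact: measurable_id.
exact: measurableT_comp measurable_odd_bits IH.
Qed.

Lemma uniform_seq_indep (A : nat -> set R) n : (forall j, measurable (A j)) ->
  uniform01 (\big[setI/setT]_(j < n) (uniform_seq j @^-1` A j)) =
  (\prod_(j < n) uniform01 (A j))%E.
Proof.
move=> mA; elim: n A mA => [|n IH] A mA; first by rewrite !big_ord0 probability_setT.
rewrite !big_ord_recl/= -(IH (fun j => A j.+1))// -even_odd_bits_law//; last first.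
  apply: bigsetI_measurable => j _.
  by apply: measurable_preimage => //; exact: measurable_uniform_seq.
congr (uniform01 (_ `&` _)).
rewrite (big_morph (preimage odd_bits) (@preimage_setI _ _ _) (@preimage_setT _ _ _)).
apply: eq_bigr => j _; apply/seteqP; split=> w; rewrite /uniform_seq/= -iterSr//.
Qed.

Lemma uniform_seq_law j A : measurable A -> uniform01 (uniform_seq j @^-1` A) = uniform01 A.
Proof.
move=> mA; elim: j => [|j IH]; first exact: even_bits_law.
rewrite -IH -[RHS]odd_bits_law; last first.
  by apply: measurable_preimage => //; exact: measurable_uniform_seq.
by congr (uniform01 _); apply/seteqP; split=> w; rewrite /uniform_seq/= -iterSr.
Qed.

End uniform01.

(** * Exponential variables by inversion *)

Section exponential_seq.
Context {R : realType}.

(** The inverse of the exponential distribution function, set to 0 outside [0, 1[ so that it is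
    nonnegative everywhere. *)
Definition quantile (u : R) : R := if 0 <= u < 1 then - ln (1 - u) else 0.

Lemma measurable_quantile : measurable_fun setT quantile.
Proof.
apply: measurable_fun_ifT => //.
- by apply: measurable_and; [apply: measurable_fun_ler|apply: measurable_fun_ltr].
- apply: measurableT_comp => //; apply: measurableT_comp; first exact: measurable_ln.
  exact: measurable_funB.
Qed.

Lemma quantile_ge0 u : 0 <= quantile u.
Proof.
rewrite /quantile; case: ifPn => // /andP[u0 u1].
by rewrite oppr_ge0 ln_le0// gerBl.
Qed.

(** Points outside [0, 1[ go to 0 and belong to the sublevel set, so its complement is an interval
    of length exp(- t). *)
Lemma quantile_le (t u : R) : 0 <= t -> (quantile u <= t) = ~~ (1 - expR (- t) < u < 1).
Proof.
move=> t0; have et : expR (- t) <= 1 by rewrite -[leRHS]expR0 ler_expR oppr_le0.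
rewrite /quantile; case: ifPn => [/andP[u0 u1]|].
  rewrite u1 andbT -leNgt lerNl -[- t]expRK ler_ln ?posrE ?expR_gt0 ?subr_gt0//.
  by rewrite expRK; apply/idP/idP => h; lra.
rewrite negb_and -!leNgt -!ltNge t0 => /orP[u0|u1]; apply/esym.
  by rewrite negb_and -leNgt (le_trans (ltW u0))// subr_ge0.
by rewrite negb_and -!leNgt u1 orbT.
Qed.

Lemma quantile_law C : measurable C -> uniform01 (quantile @^-1` C) = exponential_law C.
Proof.
move=> mC.
pose m1 : {measure set R -> \bar R} :=
  measure_function_pushforward__canonical__measure_function_Measure
    (@uniform01 R) measurable_quantile.
apply: (@eq_measure_rays _ m1 (@exponential_law R)) => //.
- by rewrite /= /pushforward preimage_setT probability_setT ltry.
- rewrite /= /pushforward preimage_setT probability_setT.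
  by rewrite -(probability_setT (@exponential_law R)).
- move=> t; rewrite /= /pushforward.
  have [t0|t0] := ltP t 0.
    rewrite (_ : _ @^-1` _ = set0) ?measure0; last first.
      apply/seteqP; split => // u /=; rewrite in_itv/= leNgt.
      by rewrite (lt_le_trans t0 (quantile_ge0 u)).
    apply/esym; have : exponential_law `]-oo, (0:R)]%classic = 0%E.
      by have := @unit_exponential_le R 0 (lexx 0); rewrite oppr0 expR0 subrr.
    apply: subset_measure0; [exact: measurable_itv|exact: measurable_itv|].
    by move=> u /=; rewrite !in_itv/= => /le_trans; apply; exact: ltW.
  transitivity (1 - expR (- t))%:E; last exact/esym/unit_exponential_le.
  have et : 0 <= 1 - expR (- t) by rewrite subr_ge0 -[leRHS]expR0 ler_expR oppr_le0.
  have et1 : 1 - expR (- t) <= 1 by rewrite gerBl expR_ge0.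
  rewrite (_ : _ @^-1` _ = ~` `]1 - expR (- t), 1[%classic); last first.
    by apply/seteqP; split => u; rewrite /= !in_itv/= quantile_le// => /negP.
  rewrite probability_setC; last exact: measurable_itv.
  rewrite (@uniform01_itv _ _ (1 - expR (- t)) 1 false true)//.
    by rewrite -EFinB; congr EFin; ring.
  apply/setIidl => u /=; rewrite !in_itv/= => /andP[u1 u2].
  by rewrite (le_trans et (ltW u1)) ltW.
Qed.

Let expo (j : nat) (w : R) : R := quantile (uniform_seq j w).

Let measurable_expo j : measurable_fun setT (expo j).
Proof. by apply: measurableT_comp; [exact: measurable_quantile|exact: measurable_uniform_seq]. Qed.

Definition exponential_seq (j : nat) : {RV (@uniform01 R) >-> R} :=
  HB.pack (expo j) (isMeasurableFun.Build _ _ _ _ _ (measurable_expo j)).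

Lemma exponential_seq_law j A : measurable A ->
  uniform01 (exponential_seq j @^-1` A) = exponential_prob 1 A.
Proof.
move=> mA; rewrite -[RHS]/(exponential_law A) -quantile_law//.
by rewrite -(@uniform_seq_law _ j _ (measurable_preimage measurable_quantile mA)).
Qed.

Lemma exponential_seq_indep (A : nat -> set R) n : (forall j, measurable (A j)) ->
  uniform01 (\big[setI/setT]_(j < n) (exponential_seq j @^-1` A j)) =
  (\prod_(j < n) uniform01 (exponential_seq j @^-1` A j))%E.
Proof.
move=> mA.
have mqA j : measurable (quantile @^-1` A j).
  by apply: measurable_preimage => //; exact: measurable_quantile.
under [RHS]eq_bigr do
  rewrite exponential_seq_law// -[exponential_prob 1 _]/(exponential_law _) -quantile_law//.
exact: (uniform_seq_indep n mqA).
Qed.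

Let cst_indep (x : R) (A : nat -> set R) n C : measurable C ->
  uniform01 (\big[setI/setT]_(j < n) ((fun _ : R => x) @^-1` A j) `&` C) =
  (\prod_(j < n) uniform01 ((fun _ : R => x) @^-1` A j) * uniform01 C)%E.
Proof.
move=> mC; elim: n A => [|n IH] A; first by rewrite !big_ord0 setTI mul1e.
rewrite !big_ord_recl/= -setIA -muleA preimage_cst; case: ifPn => _.
  by rewrite setTI probability_setT mul1e (IH (fun j => A j.+1)).
by rewrite set0I measure0 mul0e.
Qed.

Lemma record_inputs_dirac (x : R) :
  record_inputs (\d_x : probability R R)
    (fun=> cst x : {RV (@uniform01 R) >-> R}) exponential_seq.
Proof.
split=> [j A mA|j A mA|J A mA].
- rewrite /distribution /pushforward preimage_cst /= diracE.
  by case: ifP; rewrite ?probability_setT ?measure0.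
- exact: exponential_seq_law.
pose Y (i : nat + nat) : {RV (@uniform01 R) >-> R} :=
  match i with inl _ => cst x | inr j => exponential_seq j end.
rewrite -[X in bigcap _ X]/(fun i => Y i @^-1` A i).
rewrite -[RHS]/(\prod_(i <- J) uniform01 (Y i @^-1` A i))%E.
pose idx (i : nat + nat) := match i with inl j => j | inr j => j end.
pose N := (\max_(i <- J) (idx i).+1)%N.
have ltN i : i \in J -> (idx i < N)%N.
  by move=> iJ; exact: (@leq_bigmax_seq _ (enum_fset J) xpredT (fun i => (idx i).+1) i iJ isT).
(* Filling up with [setT] replaces the arbitrary finite set [J] by two initial segments of length
   [N], one of constants and one of exponentials, without changing the event or the product. *)
pose A' i := if i \in J then A i else setT.
have mA' i : measurable (A' i) by rewrite /A'; case: ifP.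
pose Ax (j : nat) := A' (inl j); pose Ae (j : nat) := A' (inr j).
have -> : \bigcap_(i in [set` J]) (Y i @^-1` A i) =
    \big[setI/setT]_(j < N) ((fun _ : R => x) @^-1` Ax j) `&`
    \big[setI/setT]_(j < N) (exponential_seq j @^-1` Ae j).
  rewrite -(bigcap_mkord N (fun j => (fun _ : R => x) @^-1` Ax j)).
  rewrite -(bigcap_mkord N (fun j => exponential_seq j @^-1` Ae j)).
  apply/seteqP; split => [w h|w [h1 h2] [j|j] iJ].
  - split=> j jN; rewrite /Ax /Ae /A'; case: ifPn => // iJ.
      exact: (h (inl j) iJ).
    exact: (h (inr j) iJ).
  - by have := h1 j (ltN _ iJ); rewrite /Ax /A' iJ.
  - by have := h2 j (ltN _ iJ); rewrite /Ae /A' iJ.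
rewrite cst_indep; last first.
  apply: bigsetI_measurable => j _.
  by apply: measurable_preimage; [exact: measurable_expo|exact: mA'].
rewrite exponential_seq_indep; last by move=> j; exact: mA'.
pose L : seq (nat + nat) := map inl (iota 0 N) ++ map inr (iota 0 N).
have -> : (\prod_(i <- J) uniform01 (Y i @^-1` A i) = \prod_(i <- L) uniform01 (Y i @^-1` A' i))%E.
  have pJ : perm_eq J [seq i <- L | i \in J].
    apply: uniq_perm; first exact: fset_uniq.
      rewrite filter_uniq// cat_uniq !map_inj_uniq ?iota_uniq//; last 2 first.
      - by move=> i j [].
      - by move=> i j [].
      by rewrite andbT; apply/hasPn => _ /mapP[j _ ->]; apply/negP => /mapP[].
    move=> i; rewrite mem_filter; case: (boolP (i \in J)) => //= iJ.
    apply/esym; rewrite mem_cat; have := ltN i iJ; case: i {iJ} => j jN.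
      by rewrite map_f// mem_iota.
    by apply/orP; right; rewrite map_f// mem_iota.
  rewrite (perm_big _ pJ)/= big_filter big_mkcond/=; apply: eq_bigr => i _.
  by rewrite /A'; case: ifP => // _; rewrite preimage_setT probability_setT.
have -> : L = map inl (index_iota 0 N) ++ map inr (index_iota 0 N).
  by rewrite /L /index_iota subn0.
by rewrite big_cat/= !big_map !big_mkord.
Qed.

End exponential_seq.

(** * Constant factors *)

Section constant_factor.
Context {R : realType}.

Lemma dirac_unit_interval (x : R) : 0 < x < 1 ->
  (\d_x : probability R R) `]0%R, 1%R[%classic = 1%E.
Proof. by move=> x01; rewrite /= diracE mem_set//= in_itv. Qed.

(** For a constant factor the equation reads exp(s (1 - x)) = 2 - x. *)
Lemma is_threshold_dirac (x : R) : 0 < x < 1 ->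
  is_threshold (\d_x : probability R R) (ln (2 - x) / (1 - x)).
Proof.
move=> x01; apply/(is_thresholdE (dirac_unit_interval x01)).
have /andP[x0 x1] := x01.
have y0 : 0 < 1 - x by rewrite subr_gt0.
split; first by rewrite divr_gt0// ln_gt0//; lra.
rewrite -(integral_unit_interval (dirac_unit_interval x01)); last 2 first.
- by apply/measurable_EFinP; exact: measurable_defect.
- move=> z; rewrite lee_fin defect_ge0// divr_ge0 ?(ltW y0)// ln_ge0//; lra.
rewrite integral_dirac//; last by apply/measurable_EFinP; exact: measurable_defect.
rewrite diracT mul1e /defect divfK ?gt_eqF// lnK ?posrE; last lra.
by rewrite (_ : 2 - x - 1 = 1 - x) ?divff ?gt_eqF//; ring.
Qed.

Lemma value_dirac_le (x s T : R) : 0 < x < 1 -> is_threshold (\d_x : probability R R) s ->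
  1 < T -> (value (fun=> cst x : {RV (@uniform01 R) >-> R}) (@exponential_seq R) T s <=
    (expR (- (s * x)))%:E)%E.
Proof.
move=> x01 ths T1; have mu01 := dirac_unit_interval x01.
have s1 := is_threshold_lt1 mu01 ths.
have /(is_thresholdE mu01)[s0 intd] := ths.
apply: (value_ub mu01 (record_inputs_dirac x) s0 (lt_trans s1 T1)).
  exact: expR_ge0.
move=> k sk; apply: next_gain_ub => //.
rewrite -lee_fin -intd -(integral_unit_interval mu01); last 2 first.
- by apply/measurable_EFinP; exact: measurable_defect.
- by move=> z; rewrite lee_fin defect_ge0// ltW.
by rewrite integral_dirac// ?diracT ?mul1e//; apply/measurable_EFinP; exact: measurable_defect.
Qed.

(** The exponent [s x] of the upper bound is replaced by the smaller rational [x / (2 - x)], which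
    visibly tends to 1 as [x] does. *)
Lemma optimal_value_dirac (x T : R) : 0 < x < 1 -> 1 < T ->
  exists2 v, optimal_values T v & (v <= (expR (- (x / (2 - x))))%:E)%E.
Proof.
move=> x01 T1; have /andP[x0 x1] := x01.
set s := ln (2 - x) / (1 - x).
exists (value (fun=> cst x : {RV (@uniform01 R) >-> R}) (@exponential_seq R) T s).
  exists (\d_x : probability R R), s, _, _, (@uniform01 R),
    (fun=> cst x), (@exponential_seq R).
  split => //; first exact: dirac_unit_interval.
    exact: is_threshold_dirac.
  exact: record_inputs_dirac.
apply: le_trans (value_dirac_le x01 (is_threshold_dirac x01) T1) _.
rewrite lee_fin ler_expR lerN2 [s * x]mulrC ler_pM2l//.
rewrite ler_pdivlMr ?subr_gt0// -ler_expR lnK ?posrE; last lra.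
(* [ln (1 + h) >= h / (1 + h)] with [h = 1 - x] *)
have := expR_ge1Dx (- ((2 - x)^-1 * (1 - x))); rewrite expRN.
have x2 : 0 < 2 - x by lra.
have -> : 1 - (2 - x)^-1 * (1 - x) = (2 - x)^-1 by field; lra.
by rewrite lef_pV2// posrE ?expR_gt0.
Qed.

End constant_factor.

Theorem proposition2 (R : realType) :
  (forall mu : probability R R, mu `]0%R, 1%R[%classic = 1%E ->
    (exists! s : R, is_threshold mu s) /\
    (forall s : R, is_threshold mu s ->
      s < 1 /\
      (forall (d : measure_display) (Omega : measurableType d)
          (P : probability Omega R) (X E : nat -> {RV P >-> R}),
        record_inputs mu X E ->
        (forall T : R, s < T -> ((expR (- s))%:E < value X E T s)%E) /\
        (forall T : R, 1 < T -> ((expR (- 1))%:E < value X E T s)%E)))) /\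
  (forall T : R, 1 < T -> ereal_inf (optimal_values T) = (expR (- 1))%:E).
Proof.
have lb (mu : probability R R) s d (Omega : measurableType d) (P : probability Omega R)
    (X E : nat -> {RV P >-> R}) T : mu `]0%R, 1%R[%classic = 1%E -> is_threshold mu s ->
    record_inputs mu X E -> s < T -> ((expR (- s))%:E < value X E T s)%E.
  by move=> mu01 ths XE sT; exact: (value_lb mu01 XE ths.1 sT ths).
have lb1 (mu : probability R R) s d (Omega : measurableType d) (P : probability Omega R)
    (X E : nat -> {RV P >-> R}) T : mu `]0%R, 1%R[%classic = 1%E -> is_threshold mu s ->
    record_inputs mu X E -> 1 < T -> ((expR (- 1))%:E < value X E T s)%E.
  move=> mu01 ths XE T1; have s1 := is_threshold_lt1 mu01 ths.
  apply: lt_trans (lb mu s _ _ _ _ _ T mu01 ths XE (lt_trans s1 T1)).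
  by rewrite lte_fin ltr_expR ltrN2.
split=> [mu mu01|T T1].
  split=> [|s ths]; first exact: threshold_unique.
  split=> [|d Omega P X E XE]; first exact: is_threshold_lt1 ths.
  by split=> T; [exact: (lb _ _ _ _ _ _ _ _ mu01 ths XE)|exact: (lb1 _ _ _ _ _ _ _ _ mu01 ths XE)].
apply/eqP; rewrite eq_le; apply/andP; split; last first.
  apply: le_ereal_inf_tmp => v [mu [s [d [T0 [P [X [E [mu01 ths XE ->]]]]]]]].
  exact/ltW/(lb1 mu).
apply/lee_addgt0Pr => eps eps0.
(* The factor will be [1 - m]. The exponent [a] then satisfies 1 - a = 2 m / (1 + m) <= 2 m <= eps,
   and the cap 1/2 keeps the factor positive. *)
pose m := Num.min (eps / 2) (1 / 2).
have m0 : 0 < m by rewrite lt_min divr_gt0//=; lra.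
have mle : m <= eps / 2 by rewrite ge_min lexx.
have m2 : m <= 1 / 2 by rewrite ge_min lexx orbT.
have x01 : 0 < 1 - m < 1 by lra.
have [v Tv vle] := optimal_value_dirac x01 T1.
apply: le_trans (ereal_inf_lbound Tv) _; apply: le_trans vle _.
rewrite -EFinD lee_fin; set a := (1 - m) / (2 - (1 - m)).
have a1 : a <= 1 by rewrite ler_pdivrMr; lra.
have a0 : 0 <= a by rewrite divr_ge0; lra.
have am : 1 - a <= eps.
  rewrite (_ : 1 - a = 2 * m / (1 + m)); last by rewrite /a; field; lra.
  by rewrite ler_pdivrMr; nra.
have ea1 : expR (- a) <= 1 by rewrite -[leRHS]expR0 ler_expR oppr_le0.
(* From exp(a - 1) >= a; then exp(- a) - exp(- 1) <= (1 - a) exp(- a) <= eps. *)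
have ae : expR (- a) * a <= expR (- 1).
  have -> : expR (- 1) = expR (- a) * expR (a - 1) by rewrite -expRD; congr expR; ring.
  by rewrite ler_pM2l ?expR_gt0// (le_trans _ (expR_ge1Dx _))//; lra.
have := expR_gt0 (- a); nra.
Qed.
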